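(* Consider an allocation process of balls into $n$ bins satisfying either conditions $\mathcal{P}_3$ and $\mathcal{W}_2$ at every round, or conditions $\mathcal{P}_2$ and $\mathcal{W}_3$ at every round (defined in the context). Then there exists a constant $\kappa>0$ such that for any $m\ge 1$, \[ \Pr\Bigl[\max_{i\in[n]} \Bigl| x_i^m - \frac{W^m}{n}\Bigr| \le \kappa \log n\Bigr] \ge 1-n^{-3}; \] in particular $\Pr[\mathrm{Gap}(m)\le \kappa\log n]\ge 1-n^{-3}$.
   Context: There are $n$ bins; $x^t$ is the load vector after round $t$ ($x^0=0$), $W^t=\sum_i x_i^t$, $y_i^t=x_i^t-W^t/n$, $\mathrm{Gap}(t)=\max_i x_i^t-W^t/n$. $B_+^t=\{i: y_i^t\ge 0\}$ (overloaded bins), $B_-^t=[n]\setminus B_+^t$ (underloaded), $\delta^t=|B_+^t|/n$. In each round $t$, with an arbitrary labeling such that $y_1^t\ge\dots\ge y_n^t$, a bin $i$ is chosen according to a distribution vector $p^t$ (which may depend on the history $\mathfrak{F}^t$); let $p_+^t=\max_{i\in B_+^t}p_i^t$ and $p_-^t=\min_{i\in B_-^t}p_i^t$. Condition $\mathcal{P}_2$: $p_+^t\le 1/n\le p_-^t$ for all $t$. Condition $\mathcal{P}_3$: $\mathcal{P}_2$ holds and there are constants $k_1,k_2\in(0,1]$ (independent of $t$) with $p_+^t\le \frac1n-\frac{k_1(1-\delta^t)}{n}$ and $p_-^t\ge \frac1n+\frac{k_2\delta^t}{n}$ for all $t$. Condition $\mathcal{W}_2$: if the chosen bin $i$ has $y_i^t<0$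 then $w_-$ balls are placed into $i$, and if $y_i^t\ge0$ then $w_+$ balls are placed into $i$, where $1\le w_+\le w_-$ are constant integers independent of $t$ and $n$. Condition $\mathcal{W}_3$: $\mathcal{W}_2$ holds with $w_+<w_-$, and additionally for each $t$ the vector $p_i^t$ is non-decreasing in $i$. Statements are for sufficiently large $n$. *)

(* Defs.v *)
From HB Require Import structures.
From mathcomp Require Import all_boot all_order all_algebra all_fingroup.
From mathcomp Require Import all_classical all_reals all_analysis.
Import Order.TTheory GRing.Theory Num.Theory.

Set Implicit Arguments.
Unset Strict Implicit.
Unset Printing Implicit Defensive.

Local Open Scope classical_set_scope.
Local Open Scope ring_scope.

(* In the round leading from load t to load t.+1, [bin t] is the chosen bin,
   [dist t] its distribution vector given the history, indexed by the bins
   themselves (not by the rank of a bin in a sorted labelling), and [balls t]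
   the number of balls placed into it. The filtration [hist] may be larger than
   the one generated by the choices, so that [dist t] may use extra
   randomness. *)
Record allocProcess (R : realType) (d : measure_display) (T : measurableType d)
    (P : probability T R) (n : nat) := AllocProcess {
  hist : nat -> set (set T);
  dist : nat -> T -> 'I_n -> R;
  bin : nat -> T -> 'I_n;
  balls : nat -> T -> nat;
  load : nat -> T -> 'I_n -> nat;
  hist_sigma_algebra : forall t, sigma_algebra setT (hist t);
  hist_measurable : forall t A, hist t A -> measurable A;
  hist_increasing : forall s t, (s <= t)%N -> hist s `<=` hist t;
  dist_ge0 : forall t w i, 0 <= dist t w i;
  dist_sum1 : forall t w, \sum_(i < n) dist t w i = 1;
  dist_adapted : forall t i (B : set R), measurable B ->
    hist t [set w | B (dist t w i)];
  bin_adapted : forall t i, hist t.+1 [set w | bin t w = i];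
  (* dist t ^~ i is a version of the conditional probability of
     {bin t = i} given hist t *)
  bin_dist : forall t i (A : set T), hist t A ->
    P (A `&` [set w | bin t w = i]) =
    (\int[P]_(w in A) (dist t w i)%:E)%E;
  load_adapted : forall t i k, hist t [set w | load t w i = k];
  load0 : forall w i, load 0%N w i = 0%N;
  loadS : forall t w i, load t.+1 w i =
    (load t w i + (if i == bin t w then balls t w else 0))%N
}.

Section Process.
Context (R : realType) (d : measure_display) (T : measurableType d)
        (P : probability T R) (n : nat) (X : allocProcess P n).

Definition totalLoad t (w : T) : nat := (\sum_(i < n) load X t w i)%N.

Definition normLoad t (w : T) (i : 'I_n) : R :=
  (load X t w i)%:R - (totalLoad t w)%:R / n%:R.

(* Loads are nonnegative, so the default value 0 of \max is harmless. *)
Definition gap t (w : T) : R :=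
  (\max_(i < n) load X t w i)%N%:R - (totalLoad t w)%:R / n%:R.

(* max_i |x_i - W/n|; the default value 0 is harmless as well. *)
Definition maxDeviation t (w : T) : R :=
  \big[Num.max/0]_(i < n) `|(load X t w i)%:R - (totalLoad t w)%:R / n%:R|.

Definition overloaded t (w : T) : {set 'I_n} := [set i | 0 <= normLoad t w i].

Definition underloaded t (w : T) : {set 'I_n} := ~: overloaded t w.

Definition delta t (w : T) : R := #|overloaded t w|%:R / n%:R.

(* Probabilities lie in [0, 1], so the default values 0 of the maximum and 1 of
   the minimum matter only over an empty set. Some bin is always overloaded. If
   none is underloaded, pminus is 1 and, as soon as n >= 2, the lower bounds
   required of it below hold trivially. *)
Definition pplus t (w : T) : R :=
  \big[Num.max/0]_(i in overloaded t w) dist X t w i.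

Definition pminus t (w : T) : R :=
  \big[Num.min/1]_(i in underloaded t w) dist X t w i.

Definition condP2 : Prop := forall t w,
  pplus t w <= 1 / n%:R /\ 1 / n%:R <= pminus t w.

Definition condP3 (k1 k2 : R) : Prop :=
  [/\ condP2, 0 < k1 <= 1, 0 < k2 <= 1 &
      forall t w,
        pplus t w <= 1 / n%:R - k1 * (1 - delta t w) / n%:R /\
        1 / n%:R + k2 * delta t w / n%:R <= pminus t w].

Definition condW2 (wplus wminus : nat) : Prop :=
  (1 <= wplus <= wminus)%N /\
  forall t w,
    balls X t w = if normLoad t w (bin X t w) < 0 then wminus else wplus.

(* The permutation s is a labelling of the bins by non-increasing load; ties
   may be broken arbitrarily, in each round and for each outcome. *)
Definition condW3 (wplus wminus : nat) : Prop :=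
  [/\ condW2 wplus wminus, (wplus < wminus)%N &
      forall t w, exists s : {perm 'I_n},
        (forall i j : 'I_n, (i <= j)%N ->
           normLoad t w (s j) <= normLoad t w (s i)) /\
        (forall i j : 'I_n, (i <= j)%N ->
           dist X t w (s i) <= dist X t w (s j))].

End Process.

(* Main.v *)
Require Import Defs.
From HB Require Import structures.
From mathcomp Require Import all_boot all_order all_algebra all_fingroup.
From mathcomp Require Import all_classical all_reals all_analysis.
From mathcomp Require Import measurable_realfun ring lra.
Import Order.TTheory GRing.Theory Num.Theory.
Local Open Scope classical_set_scope.
Local Open Scope ring_scope.

(* With y the normalised loads, overloaded bins drift down at rate
   c (1 - delta) / n and underloaded bins drift up at rate c delta / n, where
   delta is the fraction of overloaded bins. Hence sum_i exp (a y_i) and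
   sum_i exp (- a y_i) separately need delta bounded away from 1 and from 0, but
   a weighted product of them, as long as both factors are large, decreases in
   expectation whatever delta is. If only one of them is large and delta has the
   wrong value, then the other, being small, forces almost all bins to lie
   within a small distance of the mean and on the same side of it, and an
   auxiliary bounded potential (balancePot) drops at a constant rate.
   Three exponentials with exponents h^6 << h^4 << h^2, weighted by powers of h,
   give a function V with E V' <= (1 - q / n) V + 2 n^k in every single round, for
   constants q and k; therefore E V <= n^(k + 4) at all times, while V is at
   least exp (const * max_i |y_i|), and Markov's inequality concludes. *)

(** * Rounds *)

(** The choice of three exponentials comes from a chain of thresholds. A factor with weight [u] and
    exponent [a] fails to pay for the second-order errors, all of size [h^12], only if the fraction
    of bins on the opposite side of the mean is below about [h^12 / (u a)]: underloaded bins below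
    [h^6] for the first factor, overloaded bins below [h^4] for the second. In that case a potential
    of the opposite sign, with exponent [a'], has to show that this minority carries little total
    deviation. If it is small, it bounds that deviation by about [n * fraction / (h a')], so [a']
    must be much larger than [fraction / h]. This gives [h^4] against [h^6] and [h^2] against [h^4],
    with one factor [h] left over each time; [h^6] against [h^4] would fail, hence the third
    exponential. The chain needs no fourth: if the first two potentials are small, every
    [exp (h^6 y_i)] is at most [n^2], so every [exp (h^2 y_i)] is polynomial in [n] too, and a crude
    one-round bound on [V] suffices. *)

Definition overFraction {R : realType} {n : nat} (y : 'I_n -> R) : R :=
  (\sum_(i < n | 0 <= y i) 1) / n%:R.

Definition throw {R : realType} {n : nat} (y b : 'I_n -> R) (j : 'I_n) :
    'I_n -> R :=
  fun i => y i + b j * ((i == j)%:R - n%:R^-1).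

Definition expPot {R : realType} {n : nat} (a : R) (y : 'I_n -> R) : R :=
  \sum_(i < n) expR (a * y i).

(* One round seen from a fixed history: normalised loads y, distribution p,
   number b of balls a bin would receive. The last two fields say that every
   overloaded bin drifts down at rate c (1 - delta) / n and that the underloaded
   bins drift up at rate c delta / n, the latter only on average against the
   weights exp (- a y), because in the case P2, W3 it fails for single bins. *)
Record biasedRound {R : realType} {n : nat} (w c : R) (y p b : 'I_n -> R) :
    Prop := BiasedRound {
  round_sum0 : \sum_(i < n) y i = 0;
  round_p_ge0 : forall i, 0 <= p i;
  round_p_sum1 : \sum_(i < n) p i = 1;
  round_b : forall i, 1 <= b i <= w;
  round_c : 0 < c <= 1;
  round_over_p : forall i, 0 <= y i -> p i <= n%:R^-1;
  round_under_p : forall i, y i < 0 -> n%:R^-1 <= p i;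
  round_over : forall i, 0 <= y i ->
    p i * b i - (\sum_(j < n) p j * b j) / n%:R
      <= - (c * (1 - overFraction y) / n%:R);
  round_under : forall a, 0 <= a ->
    (\sum_(j < n) p j * b j + c * overFraction y) / n%:R
      * (\sum_(i < n | y i < 0) expR (- a * y i))
    <= \sum_(i < n | y i < 0) p i * b i * expR (- a * y i)
}.

Arguments round_sum0 {R n w c y p b}.
Arguments round_p_ge0 {R n w c y p b}.
Arguments round_p_sum1 {R n w c y p b}.
Arguments round_b {R n w c y p b}.
Arguments round_c {R n w c y p b}.
Arguments round_over_p {R n w c y p b}.
Arguments round_under_p {R n w c y p b}.
Arguments round_over {R n w c y p b}.
Arguments round_under {R n w c y p b}.

(** For [z <= 0] the bound [1 / (1 - z)] is good enough. For positive [z] it exceeds the quadratic,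
    so the same bound at [z / 2] is squared instead. *)
Lemma expR_le_quad {R : realType} (z : R) : z <= 4^-1 ->
  expR z <= 1 + z + z ^+ 2.
Proof.
move=> z4; have [z0|z0] := leP z 0.
  have h : expR z * (1 - z) <= 1.
    rewrite -[leRHS](expRxMexpNx_1 z) ler_wpM2l ?expR_ge0//.
    by have := expR_ge1Dx (- z).
  rewrite -(@ler_pM2r _ (1 - z)); last lra.
  apply: (le_trans h); rewrite -subr_ge0.
  have -> : (1 + z + z ^+ 2) * (1 - z) - 1 = - z * z ^+ 2 by ring.
  by rewrite mulr_ge0 ?sqr_ge0; lra.
have h : expR (z / 2) * (1 - z / 2) <= 1.
  rewrite -[leRHS](expRxMexpNx_1 (z / 2)) ler_wpM2l ?expR_ge0//.
  by have := expR_ge1Dx (- (z / 2)).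
have h2 : expR z * (1 - z / 2) ^+ 2 <= 1.
  have -> : expR z = expR (z / 2) ^+ 2 by rewrite expr2 -expRD -splitr.
  rewrite -exprMn exprn_ile1//; apply: mulr_ge0; rewrite ?expR_ge0//; lra.
rewrite -(@ler_pM2r _ ((1 - z / 2) ^+ 2)); last by apply: exprn_gt0; lra.
apply: (le_trans h2); rewrite -subr_ge0.
have -> : (1 + z + z ^+ 2) * (1 - z / 2) ^+ 2 - 1 =
  z ^+ 2 / 4 * (1 - 3 * z + z ^+ 2) by field.
by apply: mulr_ge0; nra.
Qed.

Section Counting.
Context {R : realType} {n : nat} {y : 'I_n -> R}.

Lemma sum_over_under (f : 'I_n -> R) :
  \sum_(i < n) f i = \sum_(i < n | 0 <= y i) f i + \sum_(i < n | y i < 0) f i.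
Proof.
rewrite (bigID (fun i => 0 <= y i)) /=; congr (_ + _).
by apply: eq_bigl => i; rewrite ltNge.
Qed.

Lemma overFraction_ge0 : 0 <= overFraction y.
Proof. by rewrite divr_ge0 ?ler0n// sumr_ge0. Qed.

Hypothesis n_gt0 : (0 < n)%N.

Let n0 : 0 < n%:R :> R. Proof. by rewrite ltr0n. Qed.

Lemma over_count : \sum_(i < n | 0 <= y i) 1 = n%:R * overFraction y.
Proof. by rewrite /overFraction mulrCA divff ?mulr1// gt_eqF. Qed.

Lemma under_count : \sum_(i < n | y i < 0) 1 = n%:R * (1 - overFraction y).
Proof.
have := sum_over_under (fun=> 1); rewrite sumr_const card_ord over_count; lra.
Qed.

Lemma overFraction_le1 : overFraction y <= 1.
Proof.
rewrite -subr_ge0 -(pmulr_rge0 _ n0) -under_count.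
exact: sumr_ge0.
Qed.

End Counting.

Lemma expPot_ge0 {R : realType} {n : nat} (a : R) (y : 'I_n -> R) :
  0 <= expPot a y.
Proof. by apply: sumr_ge0 => i _; exact: expR_ge0. Qed.

Section BiasedRound.
Context {R : realType} {n : nat} {w c : R} {y p b : 'I_n -> R}.
Hypothesis rd : biasedRound w c y p b.

Lemma round_n_gt0 : (0 < n)%N.
Proof.
case: n y p b rd => // y0 p0 b0 rd0; have := round_p_sum1 rd0.
by rewrite big_ord0 => /eqP; rewrite eq_sym oner_eq0.
Qed.

Lemma round_nR_gt0 : 0 < n%:R :> R.
Proof. by rewrite ltr0n round_n_gt0. Qed.

Lemma round_w_ge1 : 1 <= w.
Proof.
have /andP[b1 bw] := round_b rd (Ordinal round_n_gt0).
exact: le_trans bw.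
Qed.

Lemma meanBalls_ge1 : 1 <= \sum_(j < n) p j * b j.
Proof.
rewrite -[leLHS](round_p_sum1 rd) ler_sum// => i _.
by rewrite ler_peMr ?(round_p_ge0 rd)//; case/andP: (round_b rd i).
Qed.

Lemma meanBalls_lew : \sum_(j < n) p j * b j <= w.
Proof.
rewrite -[leRHS]mul1r -[X in X * _](round_p_sum1 rd) mulr_suml.
apply: ler_sum => i _.
by rewrite ler_wpM2l ?(round_p_ge0 rd)//; case/andP: (round_b rd i).
Qed.

(** The sinking of the mean is a common factor, and only the summand of the hit bin changes
    otherwise. The sign of [a] is free, so both drift bounds start from this identity. *)
Lemma expPot_throw (a : R) (j : 'I_n) :
  expPot a (throw y b j) =
  expR (- (a * b j / n%:R)) *
    (expPot a y + expR (a * y j) * (expR (a * b j) - 1)).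
Proof.
have e i : expR (a * throw y b j i) = expR (- (a * b j / n%:R)) *
    (expR (a * y i) + (i == j)%:R * (expR (a * y j) * (expR (a * b j) - 1))).
  have -> : a * throw y b j i = - (a * b j / n%:R) + (a * y i + a * b j * (i == j)%:R).
    by rewrite /throw; ring.
  rewrite expRD; congr (_ * _); case: eqP => [->|_].
    by rewrite expRD !mul1r mulr1; ring.
  by rewrite mulr0 addr0 mul0r addr0.
rewrite /expPot (eq_bigr _ (fun i _ => e i)) -mulr_sumr big_split /=.
rewrite -mulr_suml -natr_sum; congr (_ * (_ + _)).
by rewrite (bigD1 j) //= eqxx big1 ?addn0 ?mul1r// => i /negbTE ->.
Qed.

End BiasedRound.

(** * Drift of the exponential potentials *)

Section ExpDrift.
Context {R : realType} {n : nat} {w c : R} {y p b : 'I_n -> R}.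
Hypothesis rd : biasedRound w c y p b.

Let n0 : 0 < n%:R :> R := round_nR_gt0 rd.
Let w1 : 1 <= w := round_w_ge1 rd.

Lemma round_n_inv_le1 : n%:R^-1 <= 1 :> R.
Proof. by rewrite invf_le1// ler1n (round_n_gt0 rd). Qed.

Lemma round_mean_affine (A B C D : R) (e : 'I_n -> R) :
  \sum_(j < n) p j * (A - B * b j + (C * (b j * e j) + D * e j)) =
  A - B * (\sum_(j < n) p j * b j)
    + (C * (\sum_(j < n) p j * b j * e j) + D * (\sum_(j < n) p j * e j)).
Proof.
have hA : A = \sum_(j < n) p j * A by rewrite -mulr_suml (round_p_sum1 rd) mul1r.
rewrite {2}hA !mulr_sumr -sumrB -!big_split /=.
by apply: eq_bigr => j _; ring.
Qed.

(** Overloaded bins have [p i <= 1 / n]. Underloaded bins may have a larger [p i], but their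
    exponentials are at most 1, so together they cost at most the total probability. *)
Lemma mean_expR_le (a : R) : 0 <= a ->
  \sum_(i < n) p i * expR (a * y i) <= expPot a y / n%:R + 1.
Proof.
move=> a0; rewrite /expPot !(@sum_over_under _ _ y).
rewrite mulrDl -addrA; apply: lerD.
  rewrite mulr_suml; apply: ler_sum => i yi.
  by rewrite mulrC ler_wpM2l ?expR_ge0// (round_over_p rd).
have U0 : 0 <= (\sum_(i < n | y i < 0) expR (a * y i)) / n%:R.
  by rewrite divr_ge0 ?(ltW n0)// sumr_ge0// => i _; exact: expR_ge0.
rewrite -[leLHS]add0r; apply: lerD => //.
rewrite -[leRHS](round_p_sum1 rd) [leRHS](@sum_over_under _ _ y).
rewrite -[leLHS]add0r lerD ?sumr_ge0// => [i _|]; first exact: round_p_ge0 rd i.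
apply: ler_sum => i yi; rewrite ler_piMr ?(round_p_ge0 rd)//.
by rewrite expR_le1 mulr_ge0_le0// ltW.
Qed.

(** The underloaded bins contribute at most [w], and extending the gain [g] from the overloaded bins
    to the full potential costs at most [g * n <= 1], whence [2 * w]. *)
Lemma mean_balls_expR_le (a : R) : 0 <= a ->
  \sum_(i < n) p i * b i * expR (a * y i)
    - (\sum_(j < n) p j * b j) / n%:R * expPot a y
  <= 2 * w - c * (1 - overFraction y) / n%:R * expPot a y.
Proof.
move=> a0; set m := \sum_(j < n) p j * b j; set g := c * _ / _.
have /andP[c0 c1] := round_c rd.
have d0 := overFraction_ge0 (y := y).
have d1 := overFraction_le1 (y := y) (round_n_gt0 rd).
have m1 : 1 <= m := meanBalls_ge1 rd.
have m2 : m <= w := meanBalls_lew rd.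
have g0 : 0 <= g by rewrite divr_ge0 ?ler0n// mulr_ge0 ?subr_ge0 ?(ltW c0).
have gn : g * n%:R <= 1.
  by rewrite /g divfK ?gt_eqF//; nra.
rewrite mulr_sumr -sumrB (@sum_over_under _ _ y).
have h1 : \sum_(i < n | 0 <= y i)
    (p i * b i * expR (a * y i) - m / n%:R * expR (a * y i)) <=
    - g * \sum_(i < n | 0 <= y i) expR (a * y i).
  rewrite mulr_sumr; apply: ler_sum => i yi.
  by rewrite -mulrBl ler_wpM2r ?expR_ge0//; have := round_over rd i yi.
have e1 i : y i < 0 -> expR (a * y i) <= 1.
  by move=> yi; rewrite expR_le1 mulr_ge0_le0// ltW.
have h2 : \sum_(i < n | y i < 0)
    (p i * b i * expR (a * y i) - m / n%:R * expR (a * y i)) <= w.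
  apply: (@le_trans _ _ (\sum_(i < n | y i < 0) p i * b i)).
    apply: ler_sum => i yi; rewrite lerBlDr -[leLHS]addr0 lerD//.
      rewrite ler_piMr ?e1// mulr_ge0 ?(round_p_ge0 rd)//.
      by have /andP[] := round_b rd i; lra.
    by apply: mulr_ge0; rewrite ?expR_ge0// divr_ge0 ?(le_trans ler01 m1) ?(ltW n0).
  apply: le_trans m2; rewrite /m [leRHS](@sum_over_under _ _ y).
  rewrite lerDr sumr_ge0// => i _; rewrite mulr_ge0 ?(round_p_ge0 rd)//.
  by have /andP[] := round_b rd i; lra.
have h3 : \sum_(i < n | y i < 0) expR (a * y i) <= n%:R.
  apply: (@le_trans _ _ (\sum_(i < n | y i < 0) 1)).
    by apply: ler_sum => i yi; exact: e1.
  by rewrite (under_count (round_n_gt0 rd)) ler_piMr ?(ltW n0)//; lra.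
rewrite [expPot _ _](@sum_over_under _ _ y) mulrDr.
have h4 := ler_wpM2l g0 h3.
lra.
Qed.

(** Second-order errors arise twice, from the sinking of all bins and from the hit bin; the constant
    3 also covers the additive [2 * w + a * w ^+ 2]. *)
Lemma expPot_drift_over (a : R) : 0 < a -> a * w <= 4^-1 ->
  \sum_(j < n) p j * expPot a (throw y b j) - expPot a y <=
  a * ((3 * w ^+ 2 * a - c * (1 - overFraction y)) * (expPot a y / n%:R)
       + 3 * w ^+ 2).
Proof.
move=> a0 aw; set F := expPot a y; set m := \sum_(j < n) p j * b j.
have F0 : 0 <= F by rewrite sumr_ge0// => i _; rewrite expR_ge0.
have step j : expPot a (throw y b j) <=
    F * (1 + a ^+ 2 * w ^+ 2 / n%:R) - a / n%:R * F * b j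
    + (a * (b j * expR (a * y j)) + a ^+ 2 * w ^+ 2 * expR (a * y j)).
  have /andP[b1 bw] := round_b rd j.
  have ab : a * b j <= a * w by rewrite ler_wpM2l ?(ltW a0).
  have ab0 : 0 <= a * b j by rewrite mulr_ge0 ?(ltW a0)//; lra.
  have ni0 : 0 < n%:R^-1 :> R by rewrite invr_gt0.
  have ni1 := round_n_inv_le1.
  have ab2 : (a * b j) ^+ 2 <= a ^+ 2 * w ^+ 2.
    by rewrite -exprMn ler_sqr ?nnegrE//; nra.
  rewrite (expPot_throw) -/F mulrDr; apply: lerD.
    rewrite mulrC; have -> : F * (1 + a ^+ 2 * w ^+ 2 / n%:R) - a / n%:R * F * b j =
      F * (1 - a * b j / n%:R + a ^+ 2 * w ^+ 2 / n%:R) by ring.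
    apply: ler_wpM2l => //; apply: le_trans (expR_le_quad _ _) _.
      have : 0 <= a * b j / n%:R by rewrite divr_ge0 ?(ltW n0).
      lra.
    rewrite lerD2l sqrrN exprMn.
    apply: (@le_trans _ _ (a ^+ 2 * w ^+ 2 * (n%:R^-1) ^+ 2)).
      by rewrite ler_wpM2r ?sqr_ge0.
    apply: ler_wpM2l; first by rewrite mulr_ge0 ?sqr_ge0.
    by rewrite expr2 ler_piMl ?(ltW ni0).
  have E0 := expR_ge0 (a * y j).
  have q := expR_le_quad (a * b j) (le_trans ab aw).
  have q1 : 0 <= expR (a * b j) - 1 by have := expR_ge1Dx (a * b j); lra.
  apply: (@le_trans _ _ (expR (a * y j) * (expR (a * b j) - 1))).
    by rewrite ler_piMl ?mulr_ge0// expR_le1 oppr_le0 divr_ge0 ?(ltW n0).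
  have -> : a * (b j * expR (a * y j)) + a ^+ 2 * w ^+ 2 * expR (a * y j) =
      expR (a * y j) * (a * b j + a ^+ 2 * w ^+ 2) by ring.
  by rewrite ler_wpM2l//; lra.
apply: (@le_trans _ _ (\sum_(j < n) p j *
    (F * (1 + a ^+ 2 * w ^+ 2 / n%:R) - a / n%:R * F * b j
    + (a * (b j * expR (a * y j)) + a ^+ 2 * w ^+ 2 * expR (a * y j))) - F)).
  by rewrite lerB// ler_sum// => j _; rewrite ler_wpM2l ?(round_p_ge0 rd).
rewrite round_mean_affine -/m.
have A := mean_expR_le a (ltW a0).
have B := mean_balls_expR_le a (ltW a0).
rewrite -/F -/m in A B.
have A' : a ^+ 2 * w ^+ 2 * (\sum_(i < n) p i * expR (a * y i)) <=
    a ^+ 2 * w ^+ 2 * (F / n%:R + 1).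
  by apply: ler_wpM2l => //; rewrite mulr_ge0 ?sqr_ge0.
have B' := ler_wpM2l (ltW a0) B.
have Fn0 : 0 <= F / n%:R by rewrite divr_ge0 ?(ltW n0).
have w0 : 0 <= w := le_trans ler01 w1.
have aw2 : a ^+ 2 * w ^+ 2 <= a * w ^+ 2 / 4.
  rewrite -exprMn expr2.
  apply: (le_trans (ler_wpM2l (mulr_ge0 (ltW a0) w0) aw)).
  by rewrite ler_pM2r// expr2 mulrA ler_peMr// mulr_ge0// ltW.
have aw3 : a * (2 * w) <= a * (2 * w ^+ 2).
  by rewrite ler_pM2l// ler_pM2l// expr2 ler_peMr.
have aw4 : 0 <= a ^+ 2 * w ^+ 2 * (F / n%:R) by rewrite mulr_ge0// mulr_ge0 ?sqr_ge0.
have aw5 : 0 <= a * w ^+ 2 by rewrite mulr_ge0 ?sqr_ge0 ?(ltW a0).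
rewrite (mulrDr a) [in X in _ <= X]mulrBl [in X in _ <= X]mulrBr.
have e1 : a * (3 * w ^+ 2 * a * (F / n%:R)) = 3 * (a ^+ 2 * w ^+ 2 * (F / n%:R)) by ring.
rewrite e1.
have e2 : c * (1 - overFraction y) / n%:R * F = c * (1 - overFraction y) * (F / n%:R) by ring.
have e3 : F * (1 + a ^+ 2 * w ^+ 2 / n%:R) = F + a ^+ 2 * w ^+ 2 * (F / n%:R) by ring.
have e4 : a / n%:R * F * m = a * (m / n%:R * F) by ring.
rewrite e2 in B'; rewrite e3 e4.
lra.
Qed.

End ExpDrift.

Section ExpDriftUnder.
Context {R : realType} {n : nat} {w c : R} {y p b : 'I_n -> R}.
Hypothesis rd : biasedRound w c y p b.

(** Here the gain sits at the hit bin and is weighted by [expR (- a * y j)], which is the form of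
    [round_under]. Its second-order loss is the factor [1 - a * w]; overloaded summands are at most
    1 and only affect the additive constant. *)
Lemma expPot_drift_under (a : R) : 0 < a -> a * w <= 4^-1 ->
  \sum_(j < n) p j * expPot (- a) (throw y b j) - expPot (- a) y <=
  a * ((3 * w ^+ 2 * a - c * overFraction y) * (expPot (- a) y / n%:R)
       + 3 * w ^+ 2).
Proof.
move=> a0 aw; set F := expPot (- a) y; set m := \sum_(j < n) p j * b j.
have n0 : 0 < n%:R :> R := round_nR_gt0 rd.
have w1 : 1 <= w := round_w_ge1 rd.
have F0 : 0 <= F by rewrite sumr_ge0// => i _; rewrite expR_ge0.
have ni0 : 0 < n%:R^-1 :> R by rewrite invr_gt0.
have ni1 := round_n_inv_le1 rd.
(* The double negation and the zero coefficient match the pattern of [round_mean_affine]. *)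
have step j : expPot (- a) (throw y b j) <=
    F * (1 + a ^+ 2 * w ^+ 2 / n%:R) - (- (a / n%:R * F)) * b j
    + (- (a * (1 - a * w)) * (b j * expR (- a * y j)) + 0 * expR (- a * y j)).
  have /andP[b1 bw] := round_b rd j.
  have ab : a * b j <= a * w by rewrite ler_wpM2l ?(ltW a0).
  have ab0 : 0 <= a * b j by rewrite mulr_ge0 ?(ltW a0)//; lra.
  have ab2 : (a * b j) ^+ 2 <= a ^+ 2 * w ^+ 2.
    by rewrite -exprMn ler_sqr ?nnegrE//; nra.
  have E0 := expR_ge0 (- a * y j).
  have z0 : 0 <= a * b j / n%:R by rewrite divr_ge0 ?(ltW n0).
  have z1 : a * b j / n%:R <= a * b j by rewrite ler_piMr.
  rewrite expPot_throw -/F mul0r addr0.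
  set z := a * b j / n%:R in z0 z1 *.
  have -> : - (- a * b j / n%:R) = z by rewrite /z; ring.
  rewrite [- a * b j]mulNr.
  have D1 : a * b j * (1 - a * w) <= 1 - expR (- (a * b j)).
    have := expR_le_quad (- (a * b j)); rewrite sqrrN => q.
    have : - (a * b j) <= 4^-1 by lra.
    move=> /q; nra.
  have D0 : 0 <= 1 - expR (- (a * b j)) by apply: le_trans D1; apply: mulr_ge0; lra.
  have ez : 1 <= expR z by have := expR_ge1Dx z; lra.
  have ez2 : expR z <= 1 + z + a ^+ 2 * w ^+ 2 / n%:R.
    apply: le_trans (expR_le_quad _ _) _; first lra.
    rewrite lerD2l /z exprMn.
    apply: (@le_trans _ _ (a ^+ 2 * w ^+ 2 * (n%:R^-1) ^+ 2)).
      by rewrite ler_wpM2r ?sqr_ge0.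
    apply: ler_wpM2l; first by rewrite mulr_ge0 ?sqr_ge0.
    by rewrite expr2 ler_piMl ?(ltW ni0).
  rewrite mulrDr; apply: lerD.
    apply: (le_trans (ler_wpM2r F0 ez2)).
    by rewrite le_eqVlt; apply/orP; left; apply/eqP; rewrite /z; ring.
  have h1 : a * b j * (1 - a * w) * expR (- a * y j) <=
            (1 - expR (- (a * b j))) * expR (- a * y j) by rewrite ler_wpM2r.
  have h2 : (1 - expR (- (a * b j))) * expR (- a * y j) <=
     expR z * ((1 - expR (- (a * b j))) * expR (- a * y j)).
    by rewrite ler_peMl// mulr_ge0.
  by move: h1 h2; lra.
apply: (@le_trans _ _ (\sum_(j < n) p j *
    (F * (1 + a ^+ 2 * w ^+ 2 / n%:R) - (- (a / n%:R * F)) * b j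
    + (- (a * (1 - a * w)) * (b j * expR (- a * y j)) + 0 * expR (- a * y j))) - F)).
  by rewrite lerB// ler_sum// => j _; rewrite ler_wpM2l ?(round_p_ge0 rd).
rewrite (round_mean_affine rd) -/m mul0r addr0.
have /andP[c0 c1] := round_c rd.
have d0 := overFraction_ge0 (y := y).
have d1 := overFraction_le1 (y := y) (round_n_gt0 rd).
have m1 : 1 <= m := meanBalls_ge1 rd.
have m2 : m <= w := meanBalls_lew rd.
set k := c * overFraction y.
have k0 : 0 <= k by rewrite mulr_ge0// ltW.
have k1 : k <= 1 by rewrite /k; nra.
set H := \sum_(j < n) p j * b j * expR (- a * y j).
set S := \sum_(i < n | y i < 0) expR (- a * y i).
set O := \sum_(i < n | 0 <= y i) expR (- a * y i).
have FE : F = O + S by rewrite /F /expPot (@sum_over_under _ _ y).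
have S0 : 0 <= S by rewrite sumr_ge0// => i _; rewrite expR_ge0.
have O0 : 0 <= O by rewrite sumr_ge0// => i _; rewrite expR_ge0.
have O1 : O <= n%:R.
  apply: (@le_trans _ _ (\sum_(i < n | 0 <= y i) 1)).
    apply: ler_sum => i yi; rewrite expR_le1 mulNr oppr_le0 mulr_ge0//.
    exact: ltW.
  by rewrite (over_count (round_n_gt0 rd)) ler_piMr ?(ltW n0).
have HS : (m + k) * (S / n%:R) <= H.
  rewrite mulrCA mulrC; apply: (le_trans (round_under rd a (ltW a0))).
  rewrite /H [leRHS](@sum_over_under _ _ y) lerDr sumr_ge0// => i _.
  rewrite mulr_ge0 ?expR_ge0// mulr_ge0 ?(round_p_ge0 rd)//.
  by have /andP[] := round_b rd i; lra.
have o1 : O / n%:R <= 1 by rewrite ler_pdivrMr// mul1r.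
have o0 : 0 <= O / n%:R by rewrite divr_ge0 ?(ltW n0).
have s0 : 0 <= S / n%:R by rewrite divr_ge0 ?(ltW n0).
have fE : F / n%:R = O / n%:R + S / n%:R by rewrite FE mulrDl.
have -> : F * (1 + a ^+ 2 * w ^+ 2 / n%:R) - (- (a / n%:R * F)) * m
   + - (a * (1 - a * w)) * H - F =
   a * (a * w ^+ 2 * (F / n%:R) + m * (F / n%:R) - (1 - a * w) * H) by ring.
rewrite ler_pM2l// fE.
set s := S / _ in HS s0 *; set o := O / _ in o0 o1 *.
have h1 : (1 - a * w) * ((m + k) * s) <= (1 - a * w) * H.
  by apply: ler_wpM2l => //; lra.
have h2 : m * o <= w by rewrite -[leRHS]mulr1 ler_pM//; lra.
have h3 : k * o <= w by rewrite -[leRHS]mulr1 ler_pM//; lra.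
have h4 : a * w * ((m + k) * s) <= a * w * (2 * w * s).
  apply: ler_wpM2l; first by rewrite mulr_ge0 ?(ltW a0)//; lra.
  by apply: ler_wpM2r => //; lra.
have h5 : 0 <= a * w ^+ 2 * o by rewrite mulr_ge0// mulr_ge0 ?sqr_ge0 ?(ltW a0).
have h6 : w <= w ^+ 2 by rewrite expr2 ler_peMr//; lra.
move: h1 h2 h3 h4 h5 h6; rewrite !expr2; lra.
Qed.

End ExpDriftUnder.

(** * The balance potential *)

Definition ramp {R : realType} (x : R) : R :=
  Num.max (- 8^-1) (Num.min x 8^-1).

Definition cliff {R : realType} (x : R) : R :=
  Num.max 0 (Num.min (2 * x - 2^-1) 1).

(* Detects whether the bulk of the bins sits just above or just below the mean:
   the ramp loses when a bulk in [0, 1/8) sinks with the mean, the cliff gains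
   when a bulk in [-1/8, 0) is hit and jumps over [1/4, 3/4]. The constant 3
   only keeps the summands at least 1. *)
Definition balancePot {R : realType} {n : nat} (y : 'I_n -> R) : R :=
  \sum_(i < n) (3 + ramp (y i) - cliff (y i)).

Section Shape.
Context {R : realType}.
Implicit Types x z s : R.

Lemma rampP x : [\/ x <= - 8^-1 /\ ramp x = - 8^-1,
  - 8^-1 <= x <= 8^-1 /\ ramp x = x | 8^-1 <= x /\ ramp x = 8^-1].
Proof.
rewrite /ramp; have [x1|x1] := leP x 8^-1.
  have [x2|x2] := leP (- 8^-1) x; first by apply: Or32; split=> //; lra.
  by apply: Or31; split=> //; lra.
by apply: Or33; have [|?] := leP (- 8^-1) (8^-1 : R); split=> //; lra.
Qed.

Lemma cliffP x : [\/ x <= 4^-1 /\ cliff x = 0,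
  4^-1 <= x <= 3 / 4 /\ cliff x = 2 * x - 2^-1 | 3 / 4 <= x /\ cliff x = 1].
Proof.
rewrite /cliff; have [x1|x1] := leP (2 * x - 2^-1) 1.
  have [x2|x2] := leP 0 (2 * x - 2^-1); first by apply: Or32; split=> //; lra.
  by apply: Or31; split=> //; lra.
by apply: Or33; have [|?] := leP 0 (1 : R); split=> //; lra.
Qed.

Lemma ramp_bounds x : - 8^-1 <= ramp x <= 8^-1.
Proof. by case: (rampP x) => -[? ->]; lra. Qed.

Lemma ramp_homo x z : x <= z -> ramp x <= ramp z.
Proof. by move=> ?; case: (rampP x) => -[? ->]; case: (rampP z) => -[? ->]; lra. Qed.

Lemma ramp_sub x s : 0 <= x < 8^-1 -> 0 <= s <= 8^-1 -> ramp (x - s) = ramp x - s.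
Proof.
by move=> ? ?; case: (rampP x) => -[? ->]; case: (rampP (x - s)) => -[? ->]; lra.
Qed.

Lemma cliff_bounds x : 0 <= cliff x <= 1.
Proof. by case: (cliffP x) => -[? ->]; lra. Qed.

Lemma cliff_homo x z : x <= z -> cliff x <= cliff z.
Proof. by move=> ?; case: (cliffP x) => -[? ->]; case: (cliffP z) => -[? ->]; lra. Qed.

Lemma cliff_sub x s : 0 <= s -> cliff x - cliff (x - s) <= 2 * s.
Proof.
by move=> ?; case: (cliffP x) => -[? ->]; case: (cliffP (x - s)) => -[? ->]; lra.
Qed.

Lemma cliff0 x : x <= 4^-1 -> cliff x = 0.
Proof. by move=> ?; case: (cliffP x) => -[? ->]; lra. Qed.

Lemma cliff1 x : 3 / 4 <= x -> cliff x = 1.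
Proof. by move=> ?; case: (cliffP x) => -[? ->]; lra. Qed.

Lemma balancePot_bounds {n : nat} (y : 'I_n -> R) :
  n%:R <= balancePot y <= 4 * n%:R.
Proof.
have e (a : R) : a * n%:R = \sum_(i < n) a by rewrite sumr_const card_ord mulr_natr.
rewrite -[X in X <= _ <= _]mul1r !e; apply/andP; split; apply: ler_sum => i _;
  by have /andP[? ?] := ramp_bounds (y i); have /andP[? ?] := cliff_bounds (y i); lra.
Qed.

End Shape.

Section BalanceDrift.
Context {R : realType} {n : nat} {w c : R} {y p b : 'I_n -> R}.
Hypothesis rd : biasedRound w c y p b.
Hypothesis n20w : 20 * w <= n%:R.

Let NA : R := \sum_(i < n) (0 <= y i < 8^-1)%R%:R.
Let NB : R := \sum_(i < n) (- 8^-1 <= y i < 0)%R%:R.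
Let NH : R := \sum_(i < n) (4^-1 < y i)%R%:R.

(** Only the hit bin can raise its ramp, by at most the full range [1/4], while every other bin in
    [[0, 1/8)] loses at least [1 / n]; the [n^-1] given back accounts for the hit bin being counted
    in [NA]. By [20 * w <= n] the mean moves by at most [1/20], so a bin hit in [[-1/8, 0)] lands
    above [3/4] and gains the whole cliff. *)
Lemma balancePot_throw (j : 'I_n) :
  balancePot (throw y b j) - balancePot y <=
  4^-1 + Num.min 0 (n%:R^-1 - NA / n%:R) + 2 * w / n%:R * NH
    - (- 8^-1 <= y j < 0)%R%:R.
Proof.
have n0 : 0 < n%:R :> R := round_nR_gt0 rd.
have w1 : 1 <= w := round_w_ge1 rd.
have n20 : 20 * w <= n%:R := n20w.
have /andP[b1 bw] := round_b rd j.
have ni0 : 0 < n%:R^-1 :> R by rewrite invr_gt0.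
have wn : w / n%:R <= 20^-1 by rewrite ler_pdivrMr//; lra.
have s1 : n%:R^-1 <= b j / n%:R by rewrite ler_peMl// ltW.
have s2 : b j / n%:R <= w / n%:R by rewrite ler_pM2r.
set s := b j / n%:R in s1 s2.
have tE i : i != j -> throw y b j i = y i - s.
  by move=> /negbTE ij; rewrite /throw ij /s /=; ring.
have tj : throw y b j j = y j + b j - s by rewrite /throw eqxx /s /=; ring.
have U1 : \sum_(i < n) (ramp (throw y b j i) - ramp (y i)) <= 4^-1.
  apply: (@le_trans _ _ (\sum_(i < n) (i == j)%:R * 4^-1)).
    apply: ler_sum => i _; have [->|ij] := eqVneq i j.
      have /andP[? ?] := ramp_bounds (y j).
      by have /andP[? ?] := ramp_bounds (throw y b j j); rewrite mul1r; lra.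
    rewrite tE// mul0r subr_le0; apply: ramp_homo; lra.
  by rewrite -mulr_suml (bigD1 j) //= eqxx big1 ?addr0 ?mul1r// => i /negbTE ->.
have U2 : \sum_(i < n) (ramp (throw y b j i) - ramp (y i)) <=
    4^-1 + (n%:R^-1 - NA / n%:R).
  apply: (@le_trans _ _ (\sum_(i < n) ((i == j)%:R * (4^-1 + n%:R^-1) -
      (0 <= y i < 8^-1)%R%:R / n%:R))).
    apply: ler_sum => i _; have [->|ij] := eqVneq i j.
      have /andP[? ?] := ramp_bounds (y j).
      have /andP[? ?] := ramp_bounds (throw y b j j).
      by rewrite mul1r; case: (_ && _); rewrite /= ?mul0r ?mul1r; lra.
    rewrite tE// mul0r; case: (boolP (0 <= y i < 8^-1)) => [yi|_].
      by rewrite mul1r ramp_sub//; lra.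
    by rewrite mul0r subrr subr_le0; apply: ramp_homo; lra.
  rewrite sumrB -!mulr_suml (bigD1 j) //= eqxx big1 ?addr0 ?mul1r.
    by rewrite addrA.
  by move=> i /negbTE ->.
have V : \sum_(i < n) (cliff (y i) - cliff (throw y b j i)) <=
    2 * w / n%:R * NH - (- 8^-1 <= y j < 0)%R%:R.
  apply: (@le_trans _ _ (\sum_(i < n) (2 * w / n%:R * (4^-1 < y i)%R%:R
    - (i == j)%:R * (- 8^-1 <= y j < 0)%R%:R))).
    apply: ler_sum => i _; have [->|ij] := eqVneq i j.
      rewrite [true%:R * _]mul1r tj.
      have h : 0 <= 2 * w / n%:R * (4^-1 < y j)%R%:R.
        by rewrite mulr_ge0 ?ler0n// divr_ge0 ?(ltW n0)//; lra.
      case: (boolP (_ && _)) => [/andP[y1 y2]|_].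
        by rewrite (cliff0 (y j)) ?cliff1//= ?mulr1n; lra.
      rewrite /= mulr0n.
      have : cliff (y j) <= cliff (y j + b j - s) by apply: cliff_homo; lra.
      lra.
    rewrite tE// mul0r subr0; case: ltP => [h|h].
      rewrite mulr1; apply: (le_trans (cliff_sub _ s _)); first lra.
      by rewrite -mulrA ler_wpM2l.
    rewrite cliff0// mulr0 sub0r oppr_le0.
    by case/andP: (cliff_bounds (y i - s)).
  rewrite sumrB -mulr_sumr -mulr_suml lerB// (bigD1 j) //= eqxx big1 ?addr0 ?mul1r//.
  by move=> i /negbTE ->.
have -> : balancePot (throw y b j) - balancePot y =
   \sum_(i < n) (ramp (throw y b j i) - ramp (y i)) +
   \sum_(i < n) (cliff (y i) - cliff (throw y b j i)).
  by rewrite -sumrB -big_split; apply: eq_bigr => i _ /=; ring.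
by case: (leP 0 (n%:R^-1 - NA / n%:R)) => ?; lra.
Qed.

Lemma balancePot_drift :
  \sum_(j < n) p j * balancePot (throw y b j) - balancePot y <=
  4^-1 + Num.min 0 (n%:R^-1 - NA / n%:R) + 2 * w / n%:R * NH - NB / n%:R.
Proof.
set Q := 4^-1 + _ + _.
have hB : balancePot y = \sum_(j < n) p j * balancePot y.
  by rewrite -mulr_suml (round_p_sum1 rd) mul1r.
have hQ : Q = \sum_(j < n) p j * Q.
  by rewrite -mulr_suml (round_p_sum1 rd) mul1r.
rewrite hB -sumrB.
apply: (@le_trans _ _ (\sum_(j < n) p j * (Q - (- 8^-1 <= y j < 0)%R%:R))).
  apply: ler_sum => j _; rewrite -mulrBr ler_wpM2l ?(round_p_ge0 rd)//.
  exact: balancePot_throw.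
under eq_bigr do rewrite mulrBr.
rewrite sumrB -hQ lerB// mulr_suml; apply: ler_sum => j _.
case: (boolP (_ && _)) => [/andP[_ yj]|_]; last by rewrite mul0r mulr0.
by rewrite mul1r mulr1 (round_under_p rd).
Qed.

Lemma over_sum_under :
  \sum_(i < n | 0 <= y i) y i = \sum_(i < n | y i < 0) - y i.
Proof.
have := round_sum0 rd; rewrite (@sum_over_under _ _ y) => /eqP.
by rewrite addr_eq0 -sumrN => /eqP.
Qed.

Lemma balancePot_drift_le :
  \sum_(j < n) p j * balancePot (throw y b j) - balancePot y <= 3 * w.
Proof.
have n0 : 0 < n%:R :> R := round_nR_gt0 rd.
have w1 : 1 <= w := round_w_ge1 rd.
have n20 : 20 * w <= n%:R := n20w.
apply: (le_trans balancePot_drift).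
have h1 : Num.min 0 (n%:R^-1 - NA / n%:R) <= 0 by rewrite ge_min lexx.
have h2 : 0 <= NB / n%:R by rewrite divr_ge0 ?(ltW n0)// sumr_ge0.
have h3 : NH <= n%:R.
  apply: (@le_trans _ _ (\sum_(i < n) 1)); last by rewrite sumr_const card_ord.
  by apply: ler_sum => i _; case: ltP; rewrite ?ler01.
have h4 : 2 * w / n%:R * NH <= 2 * w.
  by rewrite mulrAC ler_pdivrMr// ler_wpM2l//; lra.
lra.
Qed.

(** Markov's inequality on each side of the mean leaves at most [8/160 = 1/20] of the bins of that
    side farther than [1/8] away, so [NA / n] or [NB / n] is at least [9/10]. The positive terms are
    at most [1/4 + 1/20 + 1/10]. *)
Lemma balancePot_drift_unbalanced :
  \sum_(i < n | 0 <= y i) y i <= n%:R / (160 * w) ->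
  19 / 20 <= overFraction y \/ overFraction y <= 20^-1 ->
  \sum_(j < n) p j * balancePot (throw y b j) - balancePot y <= - 4^-1.
Proof.
have n0 : 0 < n%:R :> R := round_nR_gt0 rd.
have w1 : 1 <= w := round_w_ge1 rd.
have n20 : 20 * w <= n%:R := n20w.
move=> Y d; apply: (le_trans balancePot_drift).
set Yp := \sum_(i < n | 0 <= y i) y i in Y.
have Yw : Yp * w / n%:R <= 160^-1.
  rewrite ler_pdivrMr//; apply: (le_trans (ler_wpM2r (le_trans ler01 w1) Y)).
  have -> : n%:R / (160 * w) * w = 160^-1 * n%:R by field; lra.
  by [].
have Yp0 : 0 <= Yp by rewrite sumr_ge0.
have Yn : Yp / n%:R <= Yp * w / n%:R.
  by rewrite ler_pM2r ?invr_gt0// ler_peMr.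
have H : NH / n%:R <= 8 * (Yp / n%:R).
  rewrite mulrA ler_pM2r ?invr_gt0// /NH (@sum_over_under _ _ y).
  rewrite -[leRHS]addr0 lerD//.
    rewrite mulr_sumr; apply: ler_sum => i yi.
    by case: ltP => ? /=; rewrite ?mulr1n ?mulr0n; lra.
  by rewrite big1// => i yi; case: ltP => //; lra.
have A : overFraction y - 8 * (Yp / n%:R) <= NA / n%:R.
  rewrite lerBlDr mulrA -mulrDl ler_pM2r ?invr_gt0//.
  rewrite /NA [X in _ <= X + _](@sum_over_under _ _ y).
  rewrite addrAC -[leLHS]addr0 lerD ?sumr_ge0//.
  rewrite mulr_sumr -big_split; apply: ler_sum => i yi /=; rewrite yi /=.
  by case: ltP => ? /=; rewrite ?mulr1n ?mulr0n; lra.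
have B : (1 - overFraction y) - 8 * (Yp / n%:R) <= NB / n%:R.
  rewrite lerBlDr mulrA -mulrDl ler_pdivlMr// mulrC -(under_count (round_n_gt0 rd)).
  rewrite /Yp over_sum_under /NB (@sum_over_under _ _ y (fun i => (- 8^-1 <= y i < 0)%R%:R)).
  rewrite -addrA -[leLHS]add0r lerD ?sumr_ge0//.
  rewrite mulr_sumr -big_split; apply: ler_sum => i yi /=; rewrite yi andbT.
  by case: (leP (- 8^-1) (y i)) => ? /=; rewrite ?mulr1n ?mulr0n; lra.
have ni : n%:R^-1 <= 20^-1 :> R.
  by rewrite lef_pV2 ?posrE//; lra.
have A0 : 0 <= NB / n%:R by rewrite divr_ge0 ?(ltW n0)// sumr_ge0.
have H' : 2 * w / n%:R * NH <= 16 * (Yp * w / n%:R).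
  have -> : 2 * w / n%:R * NH = 2 * w * (NH / n%:R) by ring.
  have -> : 16 * (Yp * w / n%:R) = 2 * w * (8 * (Yp / n%:R)) by ring.
  by rewrite ler_wpM2l//; lra.
have m1 : Num.min 0 (n%:R^-1 - NA / n%:R) <= n%:R^-1 - NA / n%:R by rewrite ge_min lexx orbT.
have m0 : Num.min 0 (n%:R^-1 - NA / n%:R) <= 0 by rewrite ge_min lexx.
case: d => d; lra.
Qed.

End BalanceDrift.

(* Weighted AM-GM with the missing weight put on the factor 1. *)
Lemma expR_weighted_le {R : realType} (t1 t2 t3 t4 f1 f2 f3 f4 g1 g2 g3 g4 : R) :
  0 <= t1 -> 0 <= t2 -> 0 <= t3 -> 0 <= t4 -> t1 + t2 + t3 + t4 <= 1 ->
  0 < f1 -> 0 < f2 -> 0 < f3 -> 0 < f4 -> 0 < g1 -> 0 < g2 -> 0 < g3 -> 0 < g4 ->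
  expR (t1 * ln g1 + t2 * ln g2 + t3 * ln g3 + t4 * ln g4) <=
  expR (t1 * ln f1 + t2 * ln f2 + t3 * ln f3 + t4 * ln f4) *
  (1 + t1 * ((g1 - f1) / f1) + t2 * ((g2 - f2) / f2) + t3 * ((g3 - f3) / f3)
     + t4 * ((g4 - f4) / f4)).
Proof.
move=> t10 t20 t30 t40 tt f10 f20 f30 f40 g10 g20 g30 g40.
set L := _ + t4 * ln f4.
set s := t1 * (ln g1 - ln f1) + t2 * (ln g2 - ln f2) + t3 * (ln g3 - ln f3)
         + t4 * (ln g4 - ln f4).
have -> : t1 * ln g1 + t2 * ln g2 + t3 * ln g3 + t4 * ln g4 = L + s.
  by rewrite /L /s; ring.
rewrite expRD ler_wpM2l ?expR_ge0//.
(* The ratio [g / f] is [e^s] times [e^(ln g - ln f - s)], bounded below by its tangent. In the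
   weighted sum the linear terms cancel, because [s] is the weighted mean of the log increments, the
   missing weight having increment 0. *)
have key f g : 0 < f -> 0 < g -> expR s * (1 + (ln g - ln f) - s) <= 1 + (g - f) / f.
  move=> f0 g0; have -> : 1 + (g - f) / f = expR s * expR (ln g - ln f - s).
    rewrite -expRD (_ : s + _ = ln g - ln f); last by ring.
    by rewrite expRB !lnK ?posrE//; field; rewrite gt_eqF.
  by rewrite ler_wpM2l ?expR_ge0//; have := expR_ge1Dx (ln g - ln f - s); lra.
have k0 : expR s * (1 - s) <= 1.
  rewrite -[leRHS](expRxMexpNx_1 s) ler_wpM2l ?expR_ge0//.
  by have := expR_ge1Dx (- s).
have k1 := ler_wpM2l t10 (key _ _ f10 g10).
have k2 := ler_wpM2l t20 (key _ _ f20 g20).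
have k3 := ler_wpM2l t30 (key _ _ f30 g30).
have k4 := ler_wpM2l t40 (key _ _ f40 g40).
have t5 : 0 <= 1 - (t1 + t2 + t3 + t4) by lra.
have k5 := ler_wpM2l t5 k0.
have e : expR s = t1 * (expR s * (1 + (ln g1 - ln f1) - s)) +
   t2 * (expR s * (1 + (ln g2 - ln f2) - s)) +
   t3 * (expR s * (1 + (ln g3 - ln f3) - s)) +
   t4 * (expR s * (1 + (ln g4 - ln f4) - s)) +
   (1 - (t1 + t2 + t3 + t4)) * (expR s * (1 - s)) by rewrite {2}/s /s; ring.
rewrite e; lra.
Qed.

(** The shift is chosen so that [a * (C * a * (F / m) + C)] equals [C * a ^+ 2 * (F + m / a) / m]:
    the additive error becomes second order relative to the shifted potential. If [F] is at least
    [m / a], it is at least half of the shifted potential, hence [g / 2]. *)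
Lemma relative_drift {R : realType} (F m a C g D : R) :
  0 < m -> 0 < a -> 0 <= F -> 0 <= g -> 0 <= C ->
  D <= a * ((C * a - g) * (F / m) + C) ->
  D / (F + m / a) <= (2 * C * a ^+ 2 - (m / a <= F)%R%:R * (a * g / 2)) / m.
Proof.
move=> m0 a0 F0 g0 C0 hD.
have ma : 0 < m / a by rewrite divr_gt0.
have G0 : 0 < F + m / a by lra.
rewrite ler_pdivrMr// mulrAC ler_pdivlMr//.
have hDm : D * m <= a * ((C * a - g) * F + C * m).
  have -> : a * ((C * a - g) * F + C * m) = a * ((C * a - g) * (F / m) + C) * m.
    by field; rewrite gt_eqF.
  by rewrite ler_pM2r.
apply: (le_trans hDm).
have e : 2 * C * a ^+ 2 * (F + m / a) = 2 * C * a ^+ 2 * F + 2 * C * a * m.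
  by field; rewrite gt_eqF.
have h1 : 0 <= C * a ^+ 2 * F by rewrite mulr_ge0// mulr_ge0 ?sqr_ge0.
have h2 : 0 <= C * a * m by rewrite mulr_ge0 ?(ltW m0)// mulr_ge0 ?(ltW a0).
have h3 : 0 <= a * g * F by rewrite mulr_ge0// mulr_ge0 ?(ltW a0).
rewrite [leRHS]mulrBl e; case: (leP (m / a) F) => hF /=.
  have h4 : a * g * (m / a) <= a * g * F by rewrite ler_wpM2l// mulr_ge0 ?(ltW a0).
  rewrite mulr1n mul1r; move: h1 h2 h3 h4; rewrite !expr2; lra.
by rewrite mulr0n !mul0r; move: h1 h2 h3; rewrite !expr2; lra.
Qed.

(** * Total deviation on one side of the mean, from an exponential potential *)

Section Concentration.
Context {R : realType} {n : nat} {w c : R}.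

(** Summand by summand this is the tangent bound [a * (- y) <= q + exp (- q - a * y)]. A large [q]
    suppresses the potential at the price of a larger coefficient on the number of underloaded bins;
    it is applied with [q = h^-1]. *)
Lemma under_sum_le {p b y : 'I_n -> R} (rd : biasedRound w c y p b) (a q : R) :
  0 < a ->
  \sum_(i < n | y i < 0) - y i <=
  q / a * (n%:R * (1 - overFraction y)) + expR (- q) / a * expPot (- a) y.
Proof.
move=> a0; rewrite -(under_count (round_n_gt0 rd)) /expPot
  [in leRHS](@sum_over_under _ _ y (fun i => expR _)).
rewrite mulrDr [X in _ + X]addrC addrA -[leLHS]addr0 lerD//; last first.
  apply: mulr_ge0; first by rewrite divr_ge0 ?expR_ge0 ?(ltW a0).
  by apply: sumr_ge0 => i _; exact: expR_ge0.
rewrite !mulr_sumr -big_split /=; apply: ler_sum => i yi.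
rewrite -(ler_pM2l a0).
have -> : a * (q / a * 1 + expR (- q) / a * expR (- a * y i)) =
   q + expR (- q + (- a * y i)) by rewrite expRD; field; rewrite gt_eqF.
by have := expR_ge1Dx (- q + (- a * y i)); lra.
Qed.

Lemma over_sum_le {p b y : 'I_n -> R} (rd : biasedRound w c y p b) (a q : R) :
  0 < a ->
  \sum_(i < n | 0 <= y i) y i <=
  q / a * (n%:R * overFraction y) + expR (- q) / a * expPot a y.
Proof.
move=> a0; rewrite -(over_count (round_n_gt0 rd)) /expPot
  [in leRHS](@sum_over_under _ _ y (fun i => expR _)).
rewrite mulrDr addrA -[leLHS]addr0 lerD//; last first.
  apply: mulr_ge0; first by rewrite divr_ge0 ?expR_ge0 ?(ltW a0).
  by apply: sumr_ge0 => i _; exact: expR_ge0.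
rewrite !mulr_sumr -big_split /=; apply: ler_sum => i yi.
rewrite -(ler_pM2l a0).
have -> : a * (q / a * 1 + expR (- q) / a * expR (a * y i)) =
   q + expR (- q + (a * y i)) by rewrite expRD; field; rewrite gt_eqF.
by have := expR_ge1Dx (- q + (a * y i)); lra.
Qed.

End Concentration.

(** * The Lyapunov function *)

(** A relative drift of [-1/16] with this weight pays the three second-order errors
    [6 * w ^+ 2 * h ^+ 12] and leaves [- h ^+ 12]. *)
Definition balanceWeight {R : realType} (w : R) : R := 16 * (18 * w ^+ 2 + 1).

(** What a first-order gain must cover, in units of [h ^+ 12]: the second-order errors, the worst
    growth [3 * w] of the weighted balance potential, and a surplus of 1. *)
Definition rateBound {R : realType} (w : R) : R :=
  18 * w ^+ 2 + 3 * w * balanceWeight w + 1.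

(** [scale_w] allows the quadratic bound on the exponential and [scale_M] keeps the total weight at
    most 1. [scale_K] and [scale_exp] bound the two terms of the deviation estimates by
    [n / (320 * w)] each, matching the [n / (160 * w)] of [balancePot_drift_unbalanced]. *)
Record goodScale {R : realType} (w c h : R) : Prop := GoodScale {
  scale_gt0 : 0 < h;
  scale_le1 : h <= 1;
  scale_w : h * w <= 4^-1;
  scale_M : balanceWeight w * h <= 1;
  scale_K : 2 * rateBound w / c * h <= (320 * w)^-1;
  scale_exp : expR (- h^-1) <= h ^+ 8 / (320 * w)
}.

Arguments scale_gt0 {R w c h}.
Arguments scale_le1 {R w c h}.
Arguments scale_w {R w c h}.
Arguments scale_M {R w c h}.
Arguments scale_K {R w c h}.
Arguments scale_exp {R w c h}.

(* The exponents h^6 << h^4 << h^2 and the weights 1, h^4, h^8 are tuned so that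
   all second-order errors weight * exponent^2 equal h^12, while every first-order
   gain weight * exponent is at least h^10. The shifts n / h^k absorb the
   first-order error due to the bins on the other side of the mean. *)
Definition lyapunov {R : realType} {n : nat} (w h : R) (y : 'I_n -> R) : R :=
  expR (4^-1 * ln (expPot (h ^+ 6) y + n%:R / h ^+ 6)
      + h ^+ 4 / 4 * ln (expPot (- h ^+ 4) y + n%:R / h ^+ 4)
      + h ^+ 8 / 4 * ln (expPot (h ^+ 2) y + n%:R / h ^+ 2)
      + balanceWeight w * h ^+ 12 / 4 * ln (balancePot y)).

Lemma balanceWeight_ge0 {R : realType} (w : R) : 0 <= balanceWeight w.
Proof. by rewrite /balanceWeight mulr_ge0// addr_ge0// mulr_ge0// sqr_ge0. Qed.

(* n times the drift of 4 * ln lyapunov: the booleans tell which exponential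
   potentials are large, r is n times the relative drift of balancePot. *)
Definition driftRate {R : realType} (w c h dl r : R) (b1 b2 b3 : bool) : R :=
  (2 * (3 * w ^+ 2) * h ^+ 6 ^+ 2 - b1%:R * (h ^+ 6 * (c * (1 - dl)) / 2))
  + h ^+ 4 * (2 * (3 * w ^+ 2) * h ^+ 4 ^+ 2 - b2%:R * (h ^+ 4 * (c * dl) / 2))
  + h ^+ 8 * (2 * (3 * w ^+ 2) * h ^+ 2 ^+ 2 - b3%:R * (h ^+ 2 * (c * (1 - dl)) / 2))
  + balanceWeight w * h ^+ 12 * r.

(** [K = 2 * Q / c] is the threshold at which a gain proportional to [1 - dl] or [dl] equals
    [Q * h ^+ 12]. Below it, the two implications supply the drop of the balance potential, unless
    the third potential is large. *)
Lemma driftRate_le {R : realType} (w c h dl r : R) (b1 b2 b3 : bool) :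
  0 < h <= 1 -> 1 <= w -> 0 < c <= 1 -> 0 <= dl <= 1 ->
  2 * rateBound w / c * h <= 1 ->
  r <= 3 * w ->
  driftRate w c h dl r b1 b2 b3 <= 1 /\
  ((b1 -> ~~ b2 -> 1 - dl <= 2 * rateBound w / c * h ^+ 6 -> r <= - 16^-1) ->
   (b2 -> ~~ b3 -> dl <= 2 * rateBound w / c * h ^+ 4 -> r <= - 16^-1) ->
   b1 || b2 -> driftRate w c h dl r b1 b2 b3 <= - h ^+ 12).
Proof.
move=> /andP[h0 h1] w1 /andP[c0 c1] /andP[d0 d1] Kh r3; rewrite /driftRate.
set Q := rateBound w in Kh *.
set M := balanceWeight w.
have w2 : 1 <= w ^+ 2 by rewrite expr_ge1//; lra.
have M0 : 0 <= M := balanceWeight_ge0 w.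
have QE : Q = 18 * w ^+ 2 + 3 * w * M + 1 by [].
have ME : M = 16 * (18 * w ^+ 2 + 1) by [].
have Q0 : 0 < Q by rewrite QE; nra.
set K := 2 * Q / c in Kh *.
have cK : c * K = 2 * Q by rewrite /K mulrC divfK// gt_eqF.
have K0 : 0 < K by rewrite /K divr_gt0//; lra.
have hp k : 0 < h ^+ k by rewrite exprn_gt0.
have hq k l : (k <= l)%N -> h ^+ l <= h ^+ k.
  by move=> kl; rewrite ler_wiXn2l// ltW.
have Kq k : K * h ^+ k.+1 <= h ^+ k.
  by rewrite exprS mulrA ler_piMl// ltW.
set H := h ^+ 12.
have H0 : 0 < H by rewrite /H.
have e1 : 2 * (3 * w ^+ 2) * h ^+ 6 ^+ 2 = 6 * w ^+ 2 * H by rewrite /H; ring.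
have e2 : h ^+ 4 * (2 * (3 * w ^+ 2) * h ^+ 4 ^+ 2) = 6 * w ^+ 2 * H by rewrite /H; ring.
have e3 : h ^+ 8 * (2 * (3 * w ^+ 2) * h ^+ 2 ^+ 2) = 6 * w ^+ 2 * H by rewrite /H; ring.
set G1 := b1%:R * (h ^+ 6 * (c * (1 - dl)) / 2).
set G2 := b2%:R * (h ^+ 4 * (c * dl) / 2).
set G3 := b3%:R * (h ^+ 2 * (c * (1 - dl)) / 2).
have H6 : h ^+ 6 * (K * h ^+ 6) * c / 2 = Q * H.
  by rewrite /H (_ : _ / 2 = h ^+ 12 * (c * K) / 2); [rewrite cK; field | ring].
have H8 : h ^+ 8 * (K * h ^+ 4) * c / 2 = Q * H.
  by rewrite /H (_ : _ / 2 = h ^+ 12 * (c * K) / 2); [rewrite cK; field | ring].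
have K12 : Q * H <= c * h ^+ 11 / 2.
  by have := ler_wpM2l (ltW c0) (Kq 11%N); rewrite mulrA cK -/H; lra.
have g11 : c * h ^+ 11 / 2 <= c * h ^+ 8 / 2.
  by rewrite ler_pM2r// ler_pM2l// hq.
have g11' : c * h ^+ 11 / 2 <= c * h ^+ 10 / 2.
  by rewrite ler_pM2r// ler_pM2l// hq.
have cd : 0 <= c * dl by rewrite mulr_ge0// ltW.
have cd' : 0 <= c * (1 - dl) by rewrite mulr_ge0 ?subr_ge0// ltW.
have G10 : 0 <= G1 by rewrite mulr_ge0 ?ler0n// divr_ge0// mulr_ge0// ltW.
have G20 : 0 <= h ^+ 4 * G2.
  by rewrite mulr_ge0 ?(ltW (hp _))// mulr_ge0 ?ler0n// divr_ge0// mulr_ge0// ltW.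
have G30 : 0 <= h ^+ 8 * G3.
  by rewrite mulr_ge0 ?(ltW (hp _))// mulr_ge0 ?ler0n// divr_ge0// mulr_ge0// ltW.
have MH0 : 0 <= M * H by rewrite mulr_ge0// ltW.
have rU : M * H * r <= M * H * (3 * w) by rewrite ler_wpM2l.
have QH : Q * H = 18 * w ^+ 2 * H + M * H * (3 * w) + H by rewrite QE; ring.
have rD : r <= - 16^-1 -> M * H * r <= - (18 * w ^+ 2 * H + H).
  move=> hr; apply: (le_trans (ler_wpM2l MH0 hr)).
  by rewrite ME; lra.
rewrite -/M e1 !mulrBr e2 e3; split.
  have Hh : H <= h by rewrite -[leRHS]expr1 hq.
  have : Q * H <= Q * h by rewrite ler_pM2l.
  have : 2 * Q * h <= 1 * c by rewrite -ler_pdivrMr// mulrAC.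
  have : 0 < Q * h by rewrite mulr_gt0.
  by lra.
move=> hA hB hb; suff main : Q * H <= G1 + h ^+ 4 * G2 + h ^+ 8 * G3 \/ r <= - 16^-1.
  by case: main => [g|/rD g]; lra.
have G2E : b2 -> h ^+ 4 * G2 = h ^+ 8 * (c * dl) / 2.
  by move=> b2T; rewrite /G2 b2T mul1r; ring.
have G1E : b1 -> G1 = h ^+ 6 * (c * (1 - dl)) / 2.
  by move=> b1T; rewrite /G1 b1T mul1r; ring.
have G3E : b3 -> h ^+ 8 * G3 = h ^+ 10 * (c * (1 - dl)) / 2.
  by move=> b3T; rewrite /G3 b3T mul1r; ring.
have [b2T|b2F] := boolP b2; last first.
  have b1T : b1 by move: hb; rewrite (negbTE b2F) orbF.
  have [dA|dA] := leP (1 - dl) (K * h ^+ 6); first by right; exact: hA.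
  left; apply: (@le_trans _ _ G1); last by lra.
  have := ler_wpM2l (ltW (mulr_gt0 (hp 6%N) c0)) (ltW dA).
  by rewrite (G1E b1T); lra.
have [dB|dB] := leP dl (K * h ^+ 4); last first.
  left; apply: (@le_trans _ _ (h ^+ 4 * G2)); last by lra.
  have := ler_wpM2l (ltW (mulr_gt0 (hp 8%N) c0)) (ltW dB).
  by rewrite (G2E b2T); lra.
have [b3T|b3F] := boolP b3; last by right; exact: hB.
left.
(* The second and third gains together are at least [h ^+ 10 * c / 2] for every [dl], since the
   second has the larger power of the scale; this exceeds [Q * H] because [K * h <= 1]. *)
have h108 : h ^+ 10 * (c * dl) <= h ^+ 8 * (c * dl) by rewrite ler_wpM2r// hq.
by rewrite (G2E b2T) (G3E b3T); lra.
Qed.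

(** * One-round drift of the Lyapunov function *)

Section LyapunovDrift.
Context {R : realType} {n : nat} {w c h : R} {y p b : 'I_n -> R}.
Hypothesis rd : biasedRound w c y p b.
Hypothesis gs : goodScale w c h.
Hypothesis n20w : 20 * w <= n%:R.

Let n0 : 0 < n%:R :> R := round_nR_gt0 rd.
Let w1 : 1 <= w := round_w_ge1 rd.
Let h0 : 0 < h := scale_gt0 gs.

Lemma scale_pow_gt0 k : 0 < h ^+ k.
Proof. exact: exprn_gt0. Qed.

Lemma scale_pow_w k : h ^+ k.+1 * w <= 4^-1.
Proof.
apply: le_trans (scale_w gs).
rewrite ler_wpM2r ?(le_trans ler01 w1)// -[leRHS]expr1.
by rewrite ler_wiXn2l ?(scale_le1 gs)// ltW.
Qed.

Lemma shifted_expPot_gt0 (a : R) k (z : 'I_n -> R) : 0 < expPot a z + n%:R / h ^+ k.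
Proof.
by rewrite ltr_wpDl ?expPot_ge0// divr_gt0// scale_pow_gt0.
Qed.

Lemma balancePot_gt0 (z : 'I_n -> R) : 0 < balancePot z.
Proof. by apply: lt_le_trans n0 _; case/andP: (balancePot_bounds z). Qed.

Lemma scale_weights :
  4^-1 + h ^+ 4 / 4 + h ^+ 8 / 4 + balanceWeight w * h ^+ 12 / 4 <= 1.
Proof.
have hk k : h ^+ k <= 1 by rewrite exprn_ile1// ?(scale_le1 gs)// ltW.
have M0 := balanceWeight_ge0 w.
have : balanceWeight w * h ^+ 12 <= 1.
  apply: le_trans (scale_M gs); rewrite ler_wpM2l// -[leRHS]expr1.
  by rewrite ler_wiXn2l ?(scale_le1 gs)// ltW.
by have := hk 4%N; have := hk 8%N; lra.
Qed.

Lemma round_mean_shift (G : ('I_n -> R) -> R) (f : R) :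
  \sum_(j < n) p j * ((G (throw y b j) - G y) / f) =
  (\sum_(j < n) p j * G (throw y b j) - G y) / f.
Proof.
have hG : G y = \sum_(j < n) p j * G y.
  by rewrite -mulr_suml (round_p_sum1 rd) mul1r.
rewrite {2}hG -sumrB mulr_suml.
by apply: eq_bigr => j _; rewrite mulrA mulrBr.
Qed.

Lemma round_mean_const (f : R) : \sum_(j < n) p j * f = f.
Proof. by rewrite -mulr_suml (round_p_sum1 rd) mul1r. Qed.

Lemma round_mean_lin (V A B C D : R) (x1 x2 x3 x4 : 'I_n -> R) :
  \sum_(j < n) p j * (V * (1 + A * x1 j + B * x2 j + C * x3 j + D * x4 j)) =
  V * (1 + A * (\sum_(j < n) p j * x1 j) + B * (\sum_(j < n) p j * x2 j)
         + C * (\sum_(j < n) p j * x3 j) + D * (\sum_(j < n) p j * x4 j)).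
Proof.
rewrite -[X in V * (X + _ + _ + _ + _)](round_p_sum1 rd) !mulr_sumr -!big_split mulr_sumr.
by apply: eq_bigr => j _ /=; ring.
Qed.

Lemma balancePot_rel_le :
  n%:R * ((\sum_(j < n) p j * balancePot (throw y b j) - balancePot y)
           / balancePot y) <= 3 * w.
Proof.
have /andP[G1 _] := balancePot_bounds y.
have D := balancePot_drift_le rd n20w.
have G0 := balancePot_gt0 y.
rewrite mulrA ler_pdivrMr//.
have := ler_wpM2l (ltW n0) D.
have : n%:R * (3 * w) <= balancePot y * (3 * w).
  by rewrite ler_wpM2r// mulr_ge0// (le_trans ler01 w1).
lra.
Qed.

Lemma balancePot_rel_unbalanced :
  \sum_(i < n | 0 <= y i) y i <= n%:R / (160 * w) ->
  19 / 20 <= overFraction y \/ overFraction y <= 20^-1 ->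
  n%:R * ((\sum_(j < n) p j * balancePot (throw y b j) - balancePot y)
           / balancePot y) <= - 16^-1.
Proof.
move=> Y d; have D := balancePot_drift_unbalanced rd n20w Y d.
have /andP[_ G1] := balancePot_bounds y.
have G0 := balancePot_gt0 y.
rewrite mulrA ler_pdivrMr//.
by have := ler_wpM2l (ltW n0) D; lra.
Qed.

Let K := 2 * rateBound w / c.

Lemma scale_K_gt0 : 0 < K.
Proof.
have /andP[c0 _] := round_c rd.
rewrite /K divr_gt0// mulr_gt0// /rateBound /balanceWeight.
have w0 : 0 <= w := le_trans ler01 w1.
by rewrite ltr_wpDl// addr_ge0// mulr_ge0 ?sqr_ge0// mulr_ge0// ?addr_ge0 ?mulr_ge0 ?sqr_ge0.
Qed.

Lemma scale_K_small k : K * h ^+ k.+1 <= 320^-1.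
Proof.
have K0 := scale_K_gt0.
have h1 : K * h ^+ k.+1 <= K * h.
  by rewrite ler_pM2l// -[leRHS]expr1 ler_wiXn2l ?(scale_le1 gs)// ltW.
apply: (le_trans h1); apply: (le_trans (scale_K gs)).
have w1' := w1; by rewrite lef_pV2 ?posrE; lra.
Qed.

(** With [q = h^-1] and [a = h ^+ 4] the counting term is [n * (K * h)], and the factor [h ^+ 8] in
    [scale_exp] cancels both [h ^+ 4] in the exponential term. *)
Lemma concentrated_of_under :
  expPot (- h ^+ 4) y <= n%:R / h ^+ 4 -> 1 - overFraction y <= K * h ^+ 6 ->
  n%:R * ((\sum_(j < n) p j * balancePot (throw y b j) - balancePot y)
           / balancePot y) <= - 16^-1.
Proof.
move=> hE hd; have K6 := scale_K_small 5; have w0 : 0 < w := lt_le_trans ltr01 w1.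
apply: balancePot_rel_unbalanced; last by left; lra.
rewrite (over_sum_under rd).
apply: (le_trans (under_sum_le rd (h ^+ 4) h^-1 (scale_pow_gt0 4))).
have u0 : 0 < 320 * w by lra.
have A1 : h^-1 / h ^+ 4 * (n%:R * (1 - overFraction y)) <= n%:R / (320 * w).
  apply: (@le_trans _ _ (h^-1 / h ^+ 4 * (n%:R * (K * h ^+ 6)))).
    apply: ler_wpM2l; first by rewrite divr_ge0 ?invr_ge0// ltW// scale_pow_gt0.
    by rewrite ler_pM2l.
  have -> : h^-1 / h ^+ 4 * (n%:R * (K * h ^+ 6)) = n%:R * (K * h).
    by field; rewrite gt_eqF.
  by rewrite ler_pM2l// (scale_K gs).
have A2 : expR (- h^-1) / h ^+ 4 * expPot (- h ^+ 4) y <= n%:R / (320 * w).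
  apply: (@le_trans _ _ (h ^+ 8 / (320 * w) / h ^+ 4 * (n%:R / h ^+ 4))).
    apply: ler_pM => //; rewrite ?expPot_ge0//.
      by rewrite divr_ge0 ?expR_ge0// ltW// scale_pow_gt0.
    by rewrite ler_pM2r ?invr_gt0 ?scale_pow_gt0// (scale_exp gs).
  rewrite le_eqVlt; apply/orP; left; apply/eqP.
  by field; rewrite !gt_eqF.
apply: (le_trans (lerD A1 A2)).
rewrite le_eqVlt; apply/orP; left; apply/eqP.
by field; rewrite !gt_eqF.
Qed.

(** The exponent [h ^+ 2] turns the counting term into [n * (K * h)]; with the exponent [h ^+ 6] of
    the first potential it would be [n * (K / h ^+ 3)]. *)
Lemma concentrated_of_over :
  expPot (h ^+ 2) y <= n%:R / h ^+ 2 -> overFraction y <= K * h ^+ 4 ->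
  n%:R * ((\sum_(j < n) p j * balancePot (throw y b j) - balancePot y)
           / balancePot y) <= - 16^-1.
Proof.
move=> hE hd; have K4 := scale_K_small 3; have w0 : 0 < w := lt_le_trans ltr01 w1.
apply: balancePot_rel_unbalanced; last by right; lra.
apply: (le_trans (over_sum_le rd (h ^+ 2) h^-1 (scale_pow_gt0 2))).
have u0 : 0 < 320 * w by lra.
have A1 : h^-1 / h ^+ 2 * (n%:R * overFraction y) <= n%:R / (320 * w).
  apply: (@le_trans _ _ (h^-1 / h ^+ 2 * (n%:R * (K * h ^+ 4)))).
    apply: ler_wpM2l; first by rewrite divr_ge0 ?invr_ge0// ltW// scale_pow_gt0.
    by rewrite ler_pM2l.
  have -> : h^-1 / h ^+ 2 * (n%:R * (K * h ^+ 4)) = n%:R * (K * h).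
    by field; rewrite gt_eqF.
  by rewrite ler_pM2l// (scale_K gs).
have A2 : expR (- h^-1) / h ^+ 2 * expPot (h ^+ 2) y <= n%:R / (320 * w).
  apply: (@le_trans _ _ (h ^+ 8 / (320 * w) / h ^+ 2 * (n%:R / h ^+ 2))).
    apply: ler_pM => //; rewrite ?expPot_ge0//.
      by rewrite divr_ge0 ?expR_ge0// ltW// scale_pow_gt0.
    by rewrite ler_pM2r ?invr_gt0 ?scale_pow_gt0// (scale_exp gs).
  have -> : h ^+ 8 / (320 * w) / h ^+ 2 * (n%:R / h ^+ 2) = n%:R / (320 * w) * h ^+ 4.
    by field; rewrite !gt_eqF.
  apply: ler_piMr; first by rewrite divr_ge0 ?(ltW n0) ?(ltW u0).
  by rewrite exprn_ile1 ?(scale_le1 gs) ?(ltW h0).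
apply: (le_trans (lerD A1 A2)).
rewrite le_eqVlt; apply/orP; left; apply/eqP.
by field; rewrite !gt_eqF.
Qed.

Let b1 := n%:R / h ^+ 6 <= expPot (h ^+ 6) y.
Let b2 := n%:R / h ^+ 4 <= expPot (- h ^+ 4) y.
Let b3 := n%:R / h ^+ 2 <= expPot (h ^+ 2) y.
Let r := n%:R * ((\sum_(j < n) p j * balancePot (throw y b j) - balancePot y)
           / balancePot y).

(** The weighted AM-GM bound replaces the product by the weighted sum of the relative drifts. The 4
    in [4 * n%:R] is the common denominator of the weights. *)
Lemma lyapunov_mean_le :
  \sum_(j < n) p j * lyapunov w h (throw y b j) <=
  lyapunov w h y * (1 + driftRate w c h (overFraction y) r b1 b2 b3 / (4 * n%:R)).
Proof.
have /andP[c0 c1] := round_c rd.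
have d0 := overFraction_ge0 (y := y).
have d1 := overFraction_le1 (y := y) (round_n_gt0 rd).
have hp := scale_pow_gt0.
have cd : 0 <= c * overFraction y := mulr_ge0 (ltW c0) d0.
have M0 := balanceWeight_ge0 w.
set f1 := expPot (h ^+ 6) y + n%:R / h ^+ 6.
set f2 := expPot (- h ^+ 4) y + n%:R / h ^+ 4.
set f3 := expPot (h ^+ 2) y + n%:R / h ^+ 2.
set f4 := balancePot y.
set V := lyapunov w h y.
have V0 : 0 <= V by rewrite expR_ge0.
pose g1 j := expPot (h ^+ 6) (throw y b j) + n%:R / h ^+ 6.
pose g2 j := expPot (- h ^+ 4) (throw y b j) + n%:R / h ^+ 4.
pose g3 j := expPot (h ^+ 2) (throw y b j) + n%:R / h ^+ 2.
pose g4 j := balancePot (throw y b j).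
apply: (@le_trans _ _ (\sum_(j < n) p j * (V * (1 + 4^-1 * ((g1 j - f1) / f1)
   + h ^+ 4 / 4 * ((g2 j - f2) / f2) + h ^+ 8 / 4 * ((g3 j - f3) / f3)
   + balanceWeight w * h ^+ 12 / 4 * ((g4 j - f4) / f4))))).
  apply: ler_sum => j _; rewrite ler_wpM2l ?(round_p_ge0 rd)//.
  apply: expR_weighted_le; rewrite ?shifted_expPot_gt0 ?balancePot_gt0//.
  - by rewrite divr_ge0// ltW.
  - by rewrite divr_ge0// ltW.
  - by rewrite divr_ge0// mulr_ge0// ltW.
  - exact: scale_weights.
rewrite round_mean_lin.
rewrite ler_wpM2l// -!addrA lerD2l !addrA.
have S1 : \sum_(j < n) p j * ((g1 j - f1) / f1) <=
   (2 * (3 * w ^+ 2) * h ^+ 6 ^+ 2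
     - b1%:R * (h ^+ 6 * (c * (1 - overFraction y)) / 2)) / n%:R.
  rewrite (round_mean_shift (fun z => expPot (h ^+ 6) z + n%:R / h ^+ 6)).
  apply: relative_drift; rewrite ?hp ?expPot_ge0 ?cd ?mulr_ge0
    ?(le_trans ler01 w1) ?(ltW c0) ?subr_ge0//.
  apply: le_trans (expPot_drift_over rd (h ^+ 6) (hp _) (scale_pow_w 5)).
  under eq_bigr do rewrite mulrDr.
  by rewrite big_split /= round_mean_const; lra.
have S2 : \sum_(j < n) p j * ((g2 j - f2) / f2) <=
   (2 * (3 * w ^+ 2) * h ^+ 4 ^+ 2
     - b2%:R * (h ^+ 4 * (c * overFraction y) / 2)) / n%:R.
  rewrite (round_mean_shift (fun z => expPot (- h ^+ 4) z + n%:R / h ^+ 4)).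
  apply: relative_drift; rewrite ?hp ?expPot_ge0 ?cd ?mulr_ge0
    ?(le_trans ler01 w1) ?(ltW c0)//.
  apply: le_trans (expPot_drift_under rd (h ^+ 4) (hp _) (scale_pow_w 3)).
  under eq_bigr do rewrite mulrDr.
  by rewrite big_split /= round_mean_const; lra.
have S3 : \sum_(j < n) p j * ((g3 j - f3) / f3) <=
   (2 * (3 * w ^+ 2) * h ^+ 2 ^+ 2
     - b3%:R * (h ^+ 2 * (c * (1 - overFraction y)) / 2)) / n%:R.
  rewrite (round_mean_shift (fun z => expPot (h ^+ 2) z + n%:R / h ^+ 2)).
  apply: relative_drift; rewrite ?hp ?expPot_ge0 ?cd ?mulr_ge0
    ?(le_trans ler01 w1) ?(ltW c0) ?subr_ge0//.
  apply: le_trans (expPot_drift_over rd (h ^+ 2) (hp _) (scale_pow_w 1)).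
  under eq_bigr do rewrite mulrDr.
  by rewrite big_split /= round_mean_const; lra.
have S4 : \sum_(j < n) p j * ((g4 j - f4) / f4) = r / n%:R.
  rewrite (round_mean_shift (fun z => balancePot z)) /r [RHS]mulrAC divff ?mul1r//.
  by rewrite gt_eqF.
have h4 : 0 <= h ^+ 4 / 4 by rewrite divr_ge0// ltW.
have h8 : 0 <= h ^+ 8 / 4 by rewrite divr_ge0// ltW.
have S2' := ler_wpM2l h4 S2; have S3' := ler_wpM2l h8 S3.
rewrite S4; move: S1 S2' S3'.
set X1 := 2 * _ * _ - _; set X2 := 2 * _ * _ - _; set X3 := 2 * _ * _ - _.
move=> S1' S2' S3'.
rewrite /driftRate -/X1 -/X2 -/X3.
have -> : (X1 + h ^+ 4 * X2 + h ^+ 8 * X3 + balanceWeight w * h ^+ 12 * r) / (4 * n%:R)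
  = 4^-1 * (X1 / n%:R) + h ^+ 4 / 4 * (X2 / n%:R) + h ^+ 8 / 4 * (X3 / n%:R)
    + balanceWeight w * h ^+ 12 / 4 * (r / n%:R).
  by field; rewrite gt_eqF.
rewrite lerD2r; apply: lerD => //; apply: lerD => //.
by rewrite ler_pM2l.
Qed.

Lemma driftRate_bounds : driftRate w c h (overFraction y) r b1 b2 b3 <= 1 /\
  (b1 || b2 -> driftRate w c h (overFraction y) r b1 b2 b3 <= - h ^+ 12).
Proof.
have [] := @driftRate_le R w c h (overFraction y) r b1 b2 b3.
- by rewrite h0 (scale_le1 gs).
- exact: w1.
- exact: round_c rd.
- by rewrite overFraction_ge0 (overFraction_le1 (round_n_gt0 rd)).
- by have := scale_K_small 0; rewrite expr1 -/K; lra.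
- exact: balancePot_rel_le.
move=> crude large; split=> //; apply: large.
- by move=> _; rewrite -ltNge => /ltW hb2 hd; exact: concentrated_of_under.
- by move=> _; rewrite -ltNge => /ltW hb3 hd; exact: concentrated_of_over.
Qed.

Lemma lyapunov_drift_large : b1 || b2 ->
  \sum_(j < n) p j * lyapunov w h (throw y b j) <=
  (1 - h ^+ 12 / (4 * n%:R)) * lyapunov w h y.
Proof.
move=> hb; apply: (le_trans lyapunov_mean_le).
rewrite [leRHS]mulrC ler_wpM2l ?expR_ge0// lerD2l -[leRHS]mulNr ler_pM2r.
  exact: (driftRate_bounds.2 hb).
by rewrite invr_gt0 mulr_gt0.
Qed.

(** Meant for rounds in which the first two potentials are small and [lyapunov] is already
    polynomial in [n]. *)
Lemma lyapunov_drift_crude :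
  \sum_(j < n) p j * lyapunov w h (throw y b j) <= 2 * lyapunov w h y.
Proof.
apply: (le_trans lyapunov_mean_le).
rewrite [leRHS]mulrC ler_wpM2l ?expR_ge0//.
rewrite -lerBrDl ler_pdivrMr ?mulr_gt0//.
have : 1 <= n%:R :> R by rewrite ler1n (round_n_gt0 rd).
by have := driftRate_bounds.1; lra.
Qed.

End LyapunovDrift.

(** The scale is an inverse integer so that passing from exponent [h ^+ 6] to [h ^+ 2] is a natural
    power. For [scale_exp], [x ^+ 9 <= 9! * expR x] has one power more than the required eight,
    which absorbs the constant [320 * w * f]. *)
Lemma exists_goodScale {R : realType} (w c : R) : 1 <= w -> 0 < c <= 1 ->
  exists2 N : nat, (0 < N)%N & goodScale w c N%:R^-1.
Proof.
move=> w1 /andP[c0 c1].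
have [f f0 hf] : exists2 f : R, 0 < f & forall x : R, 0 <= x -> x ^+ 9 <= f * expR x.
  exists (9`!)%:R; first by rewrite ltr0n fact_gt0.
  move=> x x0; rewrite mulrC -ler_pdivrMr ?ltr0n ?fact_gt0//.
  by apply: le_trans (expR_ge1Dxn 8 x0); rewrite lerDr.
have w2 : 0 <= w ^+ 2 by rewrite sqr_ge0.
set M := balanceWeight w; set Q := rateBound w.
have M0 : 0 <= M by rewrite /M /balanceWeight; lra.
have Q0 : 0 < Q by rewrite /Q /rateBound -/M; nra.
set K := 2 * Q / c.
have K0 : 0 < K by rewrite /K divr_gt0//; lra.
pose Z := 1 + 4 * w + M + 320 * w * K + 320 * w * f.
have w320 : 0 < 320 * w by lra.
have wK : 0 < 320 * w * K by rewrite mulr_gt0.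
have wf : 0 < 320 * w * f by rewrite mulr_gt0.
have Z1 : 1 <= Z by rewrite /Z; lra.
have ZN := archi_boundP (le_trans ler01 Z1).
set N := Num.bound Z in ZN.
have N0 : 0 < N%:R :> R by lra.
exists N; first by move: N0; rewrite ltr0n.
have N8 : 0 < N%:R ^+ 8 :> R by rewrite exprn_gt0.
split; rewrite -/M -/Q -/K.
- by rewrite invr_gt0.
- by rewrite invf_le1//; lra.
- by rewrite mulrC ler_pdivrMr//; rewrite /Z in ZN; lra.
- by rewrite ler_pdivrMr// mul1r; rewrite /Z in ZN; lra.
- rewrite ler_pdivrMr// mulrC ler_pdivlMr; last lra.
  by rewrite /Z in ZN; lra.
- have N8w : 0 < N%:R ^+ 8 * (320 * w) by rewrite mulr_gt0.
  rewrite invrK expRN exprVn -invfM lef_pV2 ?posrE ?expR_gt0//.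
  rewrite -(ler_pM2l f0); apply: le_trans (hf _ (ltW N0)).
  have wN : 320 * w * f <= N%:R by rewrite /Z in ZN; lra.
  by have := ler_wpM2l (ltW N8) wN; rewrite exprSr; lra.
Qed.

(** * Comparison of the Lyapunov function with deviations and with powers of [n] *)

Section LyapunovBounds.
Context {R : realType} {n N : nat} {w c : R}.
Hypothesis N0 : (0 < N)%N.
Let h : R := N%:R^-1.
Hypothesis w1 : 1 <= w.
Hypothesis gs : goodScale w c h.
Hypothesis n4 : 4 <= n%:R :> R.
Hypothesis nN : (N ^ 6 <= n)%N.

Let n0 : 0 < n%:R :> R := lt_le_trans (ltr0Sn R 3) n4.
Let h0 : 0 < h := scale_gt0 gs.

Lemma natr_div_scale k : n%:R / h ^+ k = n%:R * N%:R ^+ k.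
Proof. by rewrite /h exprVn invrK. Qed.

Lemma natr_div_scale_ge1 k : 1 <= n%:R / h ^+ k.
Proof.
rewrite natr_div_scale mulr_ege1//; last by rewrite exprn_ege1// ler1n.
by apply: le_trans n4; rewrite ler1n.
Qed.

Lemma natr_div_scale_le k : (k <= 6)%N -> n%:R / h ^+ k <= n%:R ^+ 2.
Proof.
move=> k6; rewrite natr_div_scale expr2 ler_pM2l// -natrX ler_nat.
by apply: leq_trans nN; rewrite leq_pexp2l.
Qed.

(** All logarithms are nonnegative, so one factor may be kept: the second for [y i < 0], with weight
    times exponent [h ^+ 8 / 4], and the first for [0 <= y i], where [h ^+ 6 / 4] is even larger. *)
Lemma lyapunov_lower (y : 'I_n -> R) (i : 'I_n) :
  expR (h ^+ 8 / 4 * `|y i|) <= lyapunov w h y.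
Proof.
rewrite ler_expR.
have E (a : R) : expR (a * y i) <= expPot a y.
  rewrite /expPot (bigD1 i) //= lerDl sumr_ge0// => j _; exact: expR_ge0.
have P0 (a : R) : 0 <= expPot a y := expPot_ge0 a y.
have L (a : R) k : 0 <= ln (expPot a y + n%:R / h ^+ k).
  by rewrite ln_ge0// ler_wpDl// natr_div_scale_ge1.
have L' (a : R) k : a * y i <= ln (expPot a y + n%:R / h ^+ k).
  rewrite -[leLHS]expRK ler_ln ?posrE ?expR_gt0//.
    by apply: ler_wpDr (E a); rewrite (le_trans ler01) ?natr_div_scale_ge1.
  by apply: ltr_wpDl => //; rewrite (lt_le_trans ltr01) ?natr_div_scale_ge1.
have B0 : 0 <= ln (balancePot y).
  rewrite ln_ge0//; have /andP[h1 _] := balancePot_bounds y.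
  by apply: le_trans h1; apply: le_trans n4; rewrite ler1n.
have hp k : 0 < h ^+ k by rewrite exprn_gt0.
have t2 : 0 <= h ^+ 4 / 4 by rewrite divr_ge0// ltW.
have t3 : 0 <= h ^+ 8 / 4 by rewrite divr_ge0// ltW.
have t4 : 0 <= balanceWeight w * h ^+ 12 / 4.
  by rewrite divr_ge0// mulr_ge0 ?balanceWeight_ge0// ltW.
have := mulr_ge0 t3 (L (h ^+ 2) 2%N); have := mulr_ge0 t4 B0.
have := L (h ^+ 6) 6%N; have := mulr_ge0 t2 (L (- h ^+ 4) 4%N).
have := L' (h ^+ 6) 6%N; have := ler_wpM2l t2 (L' (- h ^+ 4) 4%N).
have -> : h ^+ 4 / 4 * (- h ^+ 4 * y i) = - (h ^+ 8 / 4 * y i) by field.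
have h86 : h ^+ 8 <= h ^+ 6 by rewrite ler_wiXn2l ?(scale_le1 gs)// ltW.
move=> q1 q2 q3 q4 q5 q6; have [y0|y0] := leP 0 (y i).
  by have := ler_wpM2r y0 h86; rewrite ger0_norm//; lra.
by rewrite ltr0_norm//; lra.
Qed.

(** The third potential is controlled by the first: [expR (h ^+ 2 * y i)] is the [N ^ 4]-th power of
    [expR (h ^+ 6 * y i)], which is at most [n ^ 2]. Summation, the shift and rounding up give the
    extra 3 in the exponent; the weights sum to at most 1. *)
Lemma lyapunov_upper (y : 'I_n -> R) :
  expPot (h ^+ 6) y <= n%:R / h ^+ 6 -> expPot (- h ^+ 4) y <= n%:R / h ^+ 4 ->
  lyapunov w h y <= n%:R ^+ (2 * N ^ 4 + 3).
Proof.
move=> s1 s2; set k := (2 * N ^ 4 + 3)%N.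
have n1 : 1 <= n%:R :> R by apply: le_trans n4; rewrite ler1n.
have up a l : (a <= l)%N -> n%:R ^+ a <= n%:R ^+ l :> R by move=> al; rewrite ler_weXn2l.
have P0 (a : R) : 0 <= expPot a y := expPot_ge0 a y.
have two z : 2 * n%:R ^+ z <= n%:R ^+ z.+1 :> R.
  by rewrite exprS ler_wpM2r ?exprn_ge0 ?(ltW n0)//; have := n4; lra.
have k3 : (3 <= k)%N by rewrite /k leq_addl.
have F1 : expPot (h ^+ 6) y + n%:R / h ^+ 6 <= n%:R ^+ k.
  apply: le_trans (up _ _ k3); apply: le_trans (two 2%N).
  by have := natr_div_scale_le 6 isT; lra.
have F2 : expPot (- h ^+ 4) y + n%:R / h ^+ 4 <= n%:R ^+ k.
  apply: le_trans (up _ _ k3); apply: le_trans (two 2%N).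
  by have := natr_div_scale_le 4 isT; lra.
have F4 : balancePot y <= n%:R ^+ k.
  have /andP[_ b4] := balancePot_bounds y; apply: (le_trans b4).
  apply: (@le_trans _ _ (n%:R ^+ 2)); first by rewrite expr2 ler_wpM2r ?(ltW n0).
  exact: up (ltnW k3).
have F3 : expPot (h ^+ 2) y + n%:R / h ^+ 2 <= n%:R ^+ k.
  have e i : expR (h ^+ 2 * y i) <= n%:R ^+ (2 * N ^ 4).
    have -> : h ^+ 2 * y i = h ^+ 6 * y i * (N ^ 4)%:R.
      rewrite natrX /h; field.
      by rewrite pnatr_eq0 -lt0n.
    rewrite expRM_natr exprM lerXn2r ?nnegrE ?expR_ge0 ?exprn_ge0 ?(ltW n0)//.
    apply: le_trans (natr_div_scale_le 6 isT); apply: le_trans s1.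
    by rewrite /expPot (bigD1 i) //= lerDl sumr_ge0// => j _; exact: expR_ge0.
  have e2 : expPot (h ^+ 2) y <= n%:R ^+ (2 * N ^ 4).+1.
    apply: (@le_trans _ _ (\sum_(i < n) n%:R ^+ (2 * N ^ 4))).
      by apply: ler_sum => i _; exact: e.
    by rewrite sumr_const card_ord exprS mulr_natl.
  have e3 : n%:R / h ^+ 2 <= n%:R ^+ (2 * N ^ 4).+1.
    apply: (le_trans (natr_div_scale_le 2 isT)); apply: up.
    by rewrite ltnS muln_gt0 expn_gt0 N0.
  apply: (@le_trans _ _ (n%:R ^+ (2 * N ^ 4).+2)).
    by apply: le_trans (two _); lra.
  by apply: up; rewrite /k -addn2 leq_add2l.
have g1 a l : 0 < expPot a y + n%:R / h ^+ l.
  by apply: ltr_wpDl => //; rewrite (lt_le_trans ltr01) ?natr_div_scale_ge1.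
have g4 : 0 < balancePot y.
  by apply: lt_le_trans n0 _; have /andP[] := balancePot_bounds y.
have nk : 0 < n%:R ^+ k :> R by rewrite exprn_gt0.
have lk : 0 <= ln (n%:R ^+ k : R) by rewrite ln_ge0// exprn_ege1.
rewrite -[leRHS]lnK ?posrE// ler_expR.
have hp l : 0 < h ^+ l by rewrite exprn_gt0.
have t2 : 0 <= h ^+ 4 / 4 by rewrite divr_ge0// ltW.
have t3 : 0 <= h ^+ 8 / 4 by rewrite divr_ge0// ltW.
have t4 : 0 <= balanceWeight w * h ^+ 12 / 4.
  by rewrite divr_ge0// mulr_ge0 ?balanceWeight_ge0// ltW.
have t1 : 0 <= 4^-1 :> R by rewrite invr_ge0.
have lF f : 0 < f -> f <= n%:R ^+ k -> ln f <= ln (n%:R ^+ k : R).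
  by move=> f0 fk; rewrite ler_ln ?posrE.
have := ler_wpM2l t1 (lF _ (g1 _ 6%N) F1).
have := ler_wpM2l t2 (lF _ (g1 _ 4%N) F2).
have := ler_wpM2l t3 (lF _ (g1 _ 2%N) F3).
have := ler_wpM2l t4 (lF _ g4 F4).
have := ler_wpM2r lk (scale_weights gs).
lra.
Qed.

End LyapunovBounds.

(** * The two pairs of conditions *)

Section RoundConditions.
Context {R : realType} {n : nat}.
Variables (y p : 'I_n -> R) (wp wm c : R).
Hypothesis n_gt0 : (0 < n)%N.
Hypothesis wp1 : 1 <= wp.
Hypothesis wpm : wp <= wm.
Hypothesis y_sum0 : \sum_(i < n) y i = 0.
Hypothesis p_ge0 : forall i, 0 <= p i.
Hypothesis p_sum1 : \sum_(i < n) p i = 1.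
Hypothesis c01 : 0 < c <= 1.

Let b i := if y i < 0 then wm else wp.
Let n0 : 0 < n%:R :> R. Proof. by rewrite ltr0n. Qed.

Lemma balls_bounds i : 1 <= b i <= wm.
Proof. by rewrite /b; case: ifP => _; rewrite ?lexx ?wpm ?wp1 ?(le_trans wp1 wpm). Qed.

Lemma balls_mean_ge : wp <= \sum_(j < n) p j * b j.
Proof.
rewrite -[leLHS]mulr1 -p_sum1 mulr_sumr; apply: ler_sum => i _.
by rewrite mulrC ler_wpM2l// /b; case: ifP.
Qed.

Lemma balls_mean_le : \sum_(j < n) p j * b j <= wm.
Proof.
rewrite -[leRHS]mulr1 -p_sum1 mulr_sumr; apply: ler_sum => i _.
by rewrite mulrC ler_wpM2r//; case/andP: (balls_bounds i).
Qed.

(** The bias of [p] alone suffices: the mean number of balls lies between [wp] and [wm], so it is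
    compared with [wp] at overloaded bins and with [wm] at underloaded ones. *)
Lemma biasedRound_P3 (k1 k2 : R) : c <= k1 -> c <= k2 ->
  (forall i, 0 <= y i -> p i <= 1 / n%:R - k1 * (1 - overFraction y) / n%:R) ->
  (forall i, y i < 0 -> 1 / n%:R + k2 * overFraction y / n%:R <= p i) ->
  biasedRound wm c y p b.
Proof.
move=> ck1 ck2 hp hm; have d0 := overFraction_ge0 (y := y).
have d1 := overFraction_le1 (y := y) n_gt0.
have /andP[c0 c1] := c01.
set d := overFraction y in hp hm d0 d1 *.
have d1' : 0 <= 1 - d by rewrite subr_ge0.
have hp' i : 0 <= y i -> p i <= (1 - c * (1 - d)) / n%:R.
  move=> yi; apply: (le_trans (hp i yi)).
  by rewrite -mulrBl ler_pM2r ?invr_gt0// lerD2l lerN2 ler_wpM2r.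
have hm' i : y i < 0 -> (1 + c * d) / n%:R <= p i.
  move=> yi; apply: le_trans (hm i yi).
  by rewrite -mulrDl ler_pM2r ?invr_gt0// lerD2l ler_wpM2r.
have m1 := balls_mean_ge; have m2 := balls_mean_le.
split=> // [|i yi|i yi|i yi|a a0].
- exact: balls_bounds.
- apply: (le_trans (hp' i yi)); rewrite ler_pdivrMr// mulVf ?gt_eqF//.
  by have := mulr_ge0 (ltW c0) d1'; lra.
- apply: le_trans (hm' i yi); rewrite ler_pdivlMr// mulVf ?gt_eqF//.
  by have := mulr_ge0 (ltW c0) d0; lra.
- rewrite {1}/b ltNge yi /=.
  have h := ler_wpM2r (le_trans ler01 wp1) (hp' i yi).
  apply: (@le_trans _ _ ((1 - c * (1 - d)) / n%:R * wp - wp / n%:R)).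
    by rewrite lerB// ler_pM2r ?invr_gt0.
  have -> : (1 - c * (1 - d)) / n%:R * wp - wp / n%:R = - (wp * (c * (1 - d) / n%:R)) by ring.
  rewrite lerN2 ler_peMl//; apply: divr_ge0; last exact: ltW.
  exact: mulr_ge0 (ltW c0) d1'.
- set m := \sum_(j < n) _ in m1 m2 *.
  rewrite mulr_sumr; apply: ler_sum => i yi.
  rewrite ler_wpM2r ?expR_ge0// [b i]/b yi.
  have w0 : 0 < wm by apply: lt_le_trans wpm; apply: lt_le_trans wp1.
  apply: le_trans (ler_wpM2r (ltW w0) (hm' i yi)).
  rewrite mulrAC ler_pM2r ?invr_gt0//.
  have w1 : 1 <= wm := le_trans wp1 wpm.
  have := ler_wpM2r (mulr_ge0 (ltW c0) d0) w1.
  by rewrite -/d; lra.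
Qed.

(** Chebyshev's sum inequality: lower bins have both larger [p] and larger exponential, so all
    products [(p i - p j) * (E i - E j)] are nonnegative. *)
Lemma under_chebyshev (a : R) : 0 <= a ->
  (forall i j, y i < y j -> p j <= p i) ->
  (\sum_(i < n | y i < 0) p i) * (\sum_(i < n | y i < 0) expR (- a * y i)) <=
  (\sum_(i < n | y i < 0) 1) * (\sum_(i < n | y i < 0) p i * expR (- a * y i)).
Proof.
move=> a0 hp; set U := fun i : 'I_n => y i < 0.
set E := fun i => expR (- a * y i).
have pos : 0 <= \sum_(i < n | U i) \sum_(j < n | U j) (p i - p j) * (E i - E j).
  apply: sumr_ge0 => i _; apply: sumr_ge0 => j _; rewrite /E.
  case: (ltgtP (y i) (y j)) => [ij|ij|->]; last by rewrite subrr mulr0.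
  - rewrite mulr_ge0 ?subr_ge0 ?hp// ler_expR !mulNr lerN2.
    by rewrite ler_wpM2l// ltW.
  - rewrite mulr_le0 ?subr_le0 ?hp// ler_expR !mulNr lerN2.
    by rewrite ler_wpM2l// ltW.
have e : \sum_(i < n | U i) \sum_(j < n | U j) (p i - p j) * (E i - E j) =
  2 * ((\sum_(i < n | U i) 1) * (\sum_(i < n | U i) p i * E i)) -
  2 * ((\sum_(i < n | U i) p i) * (\sum_(i < n | U i) E i)).
  have A (f g : 'I_n -> R) : (\sum_(i < n | U i) f i) * (\sum_(j < n | U j) g j) =
      \sum_(i < n | U i) \sum_(j < n | U j) f i * g j.
    by rewrite mulr_suml; apply: eq_bigr => i _; rewrite mulr_sumr.
  have B (f g : 'I_n -> R) : \sum_(i < n | U i) \sum_(j < n | U j) f i * g j =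
      \sum_(i < n | U i) \sum_(j < n | U j) f j * g i.
    by rewrite exchange_big.
  rewrite !mulr2n !mulrDl !mul1r !A {2}(B (fun=> 1)) {2}(B p).
  rewrite opprD -!sumrN -!big_split; apply: eq_bigr => i _ /=.
  rewrite -!sumrN -!big_split; apply: eq_bigr => j _ /=.
  ring.
by move: pos; rewrite e; lra.
Qed.

(** The bias comes from the weights: overloaded bins have total probability [Pp <= d], so the mean
    number of balls exceeds [wp] by at least [(wm - wp) * (1 - d)]. On the underloaded side
    Chebyshev replaces the missing pointwise bias. *)
Lemma biasedRound_W3 : wp + 1 <= wm ->
  (forall i, 0 <= y i -> p i <= n%:R^-1) ->
  (forall i, y i < 0 -> n%:R^-1 <= p i) ->
  (forall i j, y i < y j -> p j <= p i) ->
  biasedRound wm c y p b.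
Proof.
move=> w1 hp hm hs; have d0 := overFraction_ge0 (y := y).
have d1 := overFraction_le1 (y := y) n_gt0.
have /andP[c0 c1] := c01.
set d := overFraction y in d0 d1 *.
set Pp := \sum_(i < n | 0 <= y i) p i.
set Pm := \sum_(i < n | y i < 0) p i.
have PE : Pp + Pm = 1 by rewrite -p_sum1 [RHS](@sum_over_under _ _ y).
have Pp0 : 0 <= Pp by exact: sumr_ge0.
have Pd : Pp <= d.
  rewrite /Pp -(ler_pM2l n0) -(over_count n_gt0) mulr_sumr; apply: ler_sum => i yi.
  by rewrite mulrC -ler_pdivlMr// mul1r hp.
have mE : \sum_(j < n) p j * b j = wp * Pp + wm * Pm.
  rewrite (@sum_over_under _ _ y) !mulr_sumr; congr (_ + _); apply: eq_bigr => i yi.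
    by rewrite /b ltNge yi mulrC.
  by rewrite /b yi mulrC.
have cm : c * (1 - d) <= (wm - wp) * (1 - d) by rewrite ler_wpM2r; lra.
have cd : c * d <= (wm - wp) * d by rewrite ler_wpM2r; lra.
have Pdm : (wm - wp) * Pp <= (wm - wp) * d by rewrite ler_wpM2l; lra.
split=> // [|i yi|a a0].
- exact: balls_bounds.
- rewrite {1}/b ltNge yi /= mE.
  have h := ler_wpM2r (le_trans ler01 wp1) (hp i yi).
  apply: (@le_trans _ _ (n%:R^-1 * wp - (wp * Pp + wm * Pm) / n%:R)).
    by rewrite lerD2r.
  rewrite -/d [n%:R^-1 * wp]mulrC -mulrBl -mulNr ler_pM2r ?invr_gt0//.
  have -> : Pm = 1 - Pp by lra.
  lra.
- rewrite mE -/d; set S := \sum_(i < n | _) expR _.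
  have -> : \sum_(i < n | y i < 0) p i * b i * expR (- a * y i) =
    wm * \sum_(i < n | y i < 0) p i * expR (- a * y i).
    rewrite mulr_sumr; apply: eq_bigr => i yi; rewrite /b yi; ring.
  have S0 : 0 <= S by apply: sumr_ge0 => i _; exact: expR_ge0.
  (* If [d = 1] there is no underloaded bin and both sums are empty; otherwise their number
     [n * (1 - d)] can be cancelled. *)
  have [d1e|d1n] := eqVneq d 1.
    have U0 i : y i < 0 -> False.
      move=> yi; have := under_count (y := y) n_gt0; rewrite -/d d1e subrr mulr0 => /eqP.
      rewrite psumr_eq0// => /allP /(_ i (mem_index_enum _)).
      by rewrite yi oner_eq0.
    rewrite /S !big1 ?mulr0// => i yi; exfalso; exact: U0 yi.
  have u0 : 0 < 1 - d by rewrite subr_gt0 lt_neqAle d1n.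
  have ch := under_chebyshev a a0 hs.
  rewrite (under_count n_gt0) -/d -/Pm -/S in ch.
  set H := \sum_(i < n | y i < 0) p i * expR (- a * y i) in ch *.
  have nu0 : 0 < n%:R * (1 - d) by rewrite mulr_gt0.
  rewrite -(ler_pM2l nu0).
  have -> : n%:R * (1 - d) * ((wp * Pp + wm * Pm + c * d) / n%:R * S) =
    (1 - d) * (wp * Pp + wm * Pm + c * d) * S by field; rewrite gt_eqF.
  apply: (@le_trans _ _ (wm * (Pm * S))); last first.
    by rewrite [leRHS]mulrCA ler_wpM2l// (le_trans ler01) ?(le_trans wp1).
  rewrite mulrA; apply: ler_wpM2r => //.
  have PmE : Pm = 1 - Pp by lra.
  rewrite PmE -subr_ge0.
  (* This product is exactly the difference of the two sides once [c * d] is replaced by its upper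
     bound [(wm - wp) * d]. *)
  apply: (@le_trans _ _ ((d - Pp) * (wm - (1 - d) * (wm - wp)))).
    apply: mulr_ge0; first lra.
    have : (1 - d) * (wm - wp) <= 1 * (wm - wp) by rewrite ler_wpM2r; lra.
    by have := wp1; lra.
  have := ler_wpM2l (ltW u0) cd; lra.
Qed.

End RoundConditions.

(** * Expectations *)

Lemma sigma_algebra_forall_ord {T : Type} (G : set (set T)) {n : nat}
    (B : 'I_n -> set T) :
  sigma_algebra setT G -> (forall i, G (B i)) -> G [set w | forall i, B i w].
Proof.
case=> G0 GC GU GB.
pose C (k : nat) := if insub k is Some i then setT `\` B i else set0.
have -> : [set w | forall i, B i w] = setT `\` \bigcup_k C k.
  apply/seteqP; split => w /=.
    move=> Bw; split=> // -[k _]; rewrite /C; case: insubP => [i _ _ [_]|//].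
    by apply; exact: Bw.
  move=> [_ nC] i; apply: contrapT => nB; apply: nC; exists (i : nat) => //.
  rewrite /C; case: insubP => [j _ /val_inj -> //|]; by rewrite ltn_ord.
apply: (GC); apply: GU => k; rewrite /C; case: insubP => [i _ _|_ //].
by apply: GC.
Qed.

Section Expectation.
Context {R : realType} {d : measure_display} {T : measurableType d}
        {P : probability T R} {n : nat}.
Variable X : allocProcess P n.

Definition loads t (w : T) : {ffun 'I_n -> nat} := [ffun i => load X t w i].

(** Load vectors form a countable type; [pickle] indexes the level sets by [nat], as countable
    unions require. *)
Let fiber t (k : nat) : set T := [set w | pickle (loads t w) = k].

Lemma hist_loads t (f : {ffun 'I_n -> nat}) : hist X t [set w | loads t w = f].
Proof.
have -> : [set w | loads t w = f] = [set w | forall i, load X t w i = f i].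
  apply/seteqP; split => w /=; first by move=> <- i; rewrite ffunE.
  by move=> h; apply/ffunP => i; rewrite ffunE.
apply: (@sigma_algebra_forall_ord _ _ _ (fun i => [set w | load X t w i = f i])).
  exact: hist_sigma_algebra.
by move=> i; exact: load_adapted.
Qed.

Lemma hist_fiber t k : hist X t (fiber t k).
Proof.
have [[w0 <-]|e] := pselect (exists w, pickle (loads t w) = k).
  have -> : fiber t (pickle (loads t w0)) = [set w | loads t w = loads t w0].
    apply/seteqP; split => w /=; last by rewrite /fiber /= => ->.
    exact: (pcan_inj pickleK).
  exact: hist_loads.
have -> : fiber t k = set0.
  by apply/seteqP; split => w //= h; apply: e; exists w.
by have [] := hist_sigma_algebra X t.
Qed.

Lemma fiber_cover t : \bigcup_k fiber t k = setT.
Proof. by apply/seteqP; split => w // _; exists (pickle (loads t w)). Qed.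

Lemma fiber_trivIset t : trivIset setT (fiber t).
Proof. by move=> i j _ _ [w [/= <- <-]]. Qed.

Lemma measurable_loads t (g : {ffun 'I_n -> nat} -> R) :
  measurable_fun setT (fun w => g (loads t w)).
Proof.
move=> _ B mB; rewrite setTI.
have -> : (fun w => g (loads t w)) @^-1` B =
    \bigcup_(k in [set k | exists2 f, pickle f = k & B (g f)]) fiber t k.
  apply/seteqP; split => w /=.
    by move=> Bw; exists (pickle (loads t w)) => //; exists (loads t w).
  by move=> [k [f <- Bf]] /(pcan_inj pickleK) ->.
apply: bigcup_measurable => k _; apply: (hist_measurable (t := t)).
exact: hist_fiber.
Qed.

Lemma measurable_dist t i : measurable_fun setT (fun w => dist X t w i).
Proof.
move=> _ B mB; rewrite setTI; apply: (hist_measurable (t := t)).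
exact: dist_adapted.
Qed.

Lemma measurable_bin t i : measurable [set w | bin X t w = i].
Proof. by apply: (hist_measurable (t := t.+1)); exact: bin_adapted. Qed.

(* Fiberwise over the countably many load vectors, Y is constant and bin_dist
   applies. *)
Lemma integral_bin_dist t j (Y : {ffun 'I_n -> nat} -> R) :
  (forall f, 0 <= Y f) ->
  (\int[P]_w ((\1_[set w | bin X t w = j] w * Y (loads t w))%:E) =
   \int[P]_w ((dist X t w j * Y (loads t w))%:E))%E.
Proof.
move=> Y0.
have mF k : measurable (fiber t k).
  by apply: (hist_measurable (t := t)); exact: hist_fiber.
have mb := measurable_bin t j.
have m1 : measurable_fun setT (fun w => (\1_[set w | bin X t w = j] w * Y (loads t w) : R)).
  by apply: measurable_funM => //; exact: measurable_loads.
have m2 : measurable_fun setT (fun w => dist X t w j * Y (loads t w)).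
  by apply: measurable_funM; [exact: measurable_dist | exact: measurable_loads].
rewrite -(fiber_cover t) !ge0_integral_bigcup//; last 6 first.
- by rewrite fiber_cover; apply/measurable_EFinP.
- by move=> w _; rewrite lee_fin mulr_ge0// dist_ge0.
- exact: fiber_trivIset.
- by rewrite fiber_cover; apply/measurable_EFinP.
- by move=> w _; rewrite lee_fin mulr_ge0.
- exact: fiber_trivIset.
apply: eq_eseriesr => k _.
have [[w0 kE]|e] := pselect (exists w, pickle (loads t w) = k); last first.
  have -> : fiber t k = set0.
    by apply/seteqP; split => w //= h; apply: e; exists w.
  by rewrite !integral_set0.
have fE w : fiber t k w -> loads t w = loads t w0.
  by rewrite /fiber /= -kE; exact: (pcan_inj pickleK).
transitivity (\int[P]_(w in fiber t k) ((Y (loads t w0))%:E *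
    (\1_[set w | bin X t w = j] w)%:E))%E.
  apply: eq_integral => w; rewrite inE => /fE ->.
  by rewrite mulrC EFinM.
rewrite ge0_integralZl_EFin//; last first.
  by apply/measurable_EFinP; apply: measurable_funTS; exact: measurable_indic.
rewrite integral_indic// setIC.
transitivity ((Y (loads t w0))%:E * \int[P]_(w in fiber t k) (dist X t w j)%:E)%E.
  by congr (_ * _)%E; exact: bin_dist (hist_fiber t k).
rewrite -ge0_integralZl_EFin//; last 2 first.
- by move=> w _; rewrite lee_fin dist_ge0.
- by apply/measurable_EFinP; apply: measurable_funTS; exact: measurable_dist.
by apply: eq_integral => w; rewrite inE => /fE ->; rewrite mulrC EFinM.
Qed.

(** Splitting by the chosen bin writes [V] of the next loads as a sum of indicators times functions
    of the current loads. [integral_bin_dist] then replaces each indicator by [dist], and the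
    pointwise drift bound can be integrated. *)
Lemma expectation_step t (V : {ffun 'I_n -> nat} -> R)
    (nx : {ffun 'I_n -> nat} -> 'I_n -> {ffun 'I_n -> nat}) (rho B : R) :
  (forall f, 0 <= V f) -> 0 <= rho -> 0 <= B ->
  (forall w, loads t.+1 w = nx (loads t w) (bin X t w)) ->
  (forall w, \sum_(j < n) dist X t w j * V (nx (loads t w) j)
             <= rho * V (loads t w) + B) ->
  (\int[P]_w (V (loads t.+1 w))%:E <=
   rho%:E * \int[P]_w (V (loads t w))%:E + B%:E)%E.
Proof.
move=> V0 rho0 B0 hnx hd.
have mU j : measurable_fun setT (fun w => V (nx (loads t w) j)).
  exact: (measurable_loads t (fun f => V (nx f j))).
have e : (\int[P]_w (V (loads t.+1 w))%:E =
   \sum_(j < n) \int[P]_w (\1_[set w | bin X t w = j] w * V (nx (loads t w) j))%:E)%E.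
  rewrite -ge0_integral_sum//; last 2 first.
  - move=> j; apply/measurable_EFinP; apply: measurable_funM => //.
    by apply: measurable_indic; exact: measurable_bin.
  - by move=> j w _; rewrite lee_fin mulr_ge0.
  apply: eq_integral => w _; rewrite sumEFin; congr EFin.
  rewrite hnx (bigD1 (bin X t w)) //= indicE mem_set// mul1r big1 ?addr0//.
  move=> j jb; rewrite indicE memNset ?mul0r//=.
  by move=> bj; move: jb; rewrite bj eqxx.
rewrite e (eq_bigr _ (fun j _ => integral_bin_dist t j
  (fun f => V (nx f j)) (fun f => V0 _))).
rewrite -ge0_integral_sum//; last 2 first.
- move=> j; apply/measurable_EFinP; apply: measurable_funM => //.
  exact: measurable_dist.
- by move=> j w _; rewrite lee_fin mulr_ge0// dist_ge0.
apply: (@le_trans _ _ (\int[P]_w (rho%:E * (V (loads t w))%:E + B%:E))%E).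
  apply: ge0_le_integral => //.
  - by move=> w _; rewrite sume_ge0// => j _; rewrite lee_fin mulr_ge0// dist_ge0.
  - apply: emeasurable_sum => j; apply/measurable_EFinP; apply: measurable_funM => //.
    exact: measurable_dist.
  - apply: emeasurable_funD => //.
    apply/measurable_EFinP; apply: measurable_funM => //; exact: measurable_loads.
  - by move=> w _; rewrite sumEFin -EFinM -EFinD lee_fin.
rewrite ge0_integralD//; last 2 first.
- by move=> w _; rewrite -EFinM lee_fin mulr_ge0.
- by apply/measurable_EFinP; apply: measurable_funM => //; exact: measurable_loads.
rewrite ge0_integralZl_EFin//; last 2 first.
- by move=> w _; rewrite lee_fin.
- by apply/measurable_EFinP; exact: measurable_loads.
rewrite leeD2l// integral_cst// [X in (_ * X)%E](_ : _ = 1%E) ?mule1//.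
exact: probability_setT.
Qed.

End Expectation.

Section NormalizedLoads.
Context {R : realType} {n : nat}.
Implicit Type f : {ffun 'I_n -> nat}.

Definition normOf f (i : 'I_n) : R := (f i)%:R - (\sum_(j < n) f j)%N%:R / n%:R.

Definition ballsOf (wp wm : nat) f (i : 'I_n) : nat :=
  if normOf f i < 0 then wm else wp.

Definition nextLoads (wp wm : nat) f (j : 'I_n) : {ffun 'I_n -> nat} :=
  [ffun i => (f i + (if i == j then ballsOf wp wm f j else 0))%N].

Lemma normOf_nextLoads (wp wm : nat) f j :
  normOf (nextLoads wp wm f j) =
  throw (normOf f) (fun i => if normOf f i < 0 then wm%:R else wp%:R) j.
Proof.
apply/funext => i; rewrite /normOf /throw ffunE.
rewrite -/(normOf f j).
have -> : (\sum_(i0 < n) nextLoads wp wm f j i0 =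
    \sum_(i0 < n) f i0 + ballsOf wp wm f j)%N.
  under eq_bigr do rewrite ffunE.
  by rewrite big_split /= -big_mkcond /= big_pred1_eq.
have bE : (if normOf f j < 0 then wm%:R else wp%:R) = (ballsOf wp wm f j)%:R :> R.
  by rewrite /ballsOf; case: ifP.
rewrite bE !natrD mulrDl; case: eqP => _ /=; last by rewrite !mulr0n; ring.
by rewrite mulr1n; ring.
Qed.

Lemma normOf_sum0 f : (0 < n)%N -> \sum_(i < n) normOf f i = 0.
Proof.
move=> n0; rewrite /normOf sumrB natr_sum sumr_const card_ord.
by rewrite -[X in _ - X]mulr_natr divfK ?subrr// pnatr_eq0 -lt0n.
Qed.

End NormalizedLoads.

Arguments ballsOf R {n}.
Arguments nextLoads R {n}.

Section ProcessRounds.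
Context {R : realType} {d : measure_display} {T : measurableType d}
        {P : probability T R} {n : nat}.
Variables (X : allocProcess P n) (wp wm : nat).
Hypothesis n_gt0 : (0 < n)%N.

Lemma normLoad_loads t w : normLoad X t w = normOf (R := R) (loads X t w).
Proof.
apply/funext => i; rewrite /normLoad /normOf /totalLoad ffunE.
by under [in RHS]eq_bigr do rewrite ffunE.
Qed.

Lemma loads_nextLoads t w : condW2 X wp wm ->
  loads X t.+1 w = nextLoads R wp wm (loads X t w) (bin X t w).
Proof.
move=> [_ hb]; apply/ffunP => i; rewrite /nextLoads !ffunE loadS hb.
by rewrite normLoad_loads.
Qed.

Lemma over_le_pplus t w i : 0 <= normLoad X t w i -> dist X t w i <= pplus X t w.
Proof. by move=> yi; apply: le_bigmax_cond; rewrite inE. Qed.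

Lemma under_ge_pminus t w i : normLoad X t w i < 0 -> pminus X t w <= dist X t w i.
Proof. by move=> yi; apply: bigmin_le_cond; rewrite !inE -ltNge. Qed.

Lemma overFraction_delta t w : overFraction (normLoad X t w) = delta X t w.
Proof.
rewrite /overFraction /delta; congr (_ / _).
by rewrite sumr_const /overloaded cardsE.
Qed.

Lemma process_round (c k1 k2 : R) : 0 < c <= 1 ->
  (0 < k1 -> 0 < k2 -> c <= k1 /\ c <= k2) ->
  (condP3 X k1 k2 /\ condW2 X wp wm) \/ (condP2 X /\ condW3 X wp wm) ->
  forall t w, biasedRound wm%:R c (normOf (R := R) (loads X t w)) (dist X t w)
    (fun i => if normOf (R := R) (loads X t w) i < 0 then wm%:R else wp%:R).
Proof.
move=> c01 ck hc t w; rewrite -normLoad_loads.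
have y0 : \sum_(i < n) normLoad X t w i = 0.
  by rewrite normLoad_loads normOf_sum0.
have p0 := dist_ge0 X t w; have p1 := dist_sum1 X t w.
case: hc => -[].
  move=> [P2 /andP[k10 k11] /andP[k20 k21] P3] [/andP[w1 w2] _].
  have [ck1 ck2] := ck k10 k20.
  have [hp hm] := P3 t w.
  apply: (biasedRound_P3 _ _ _ _ _ _ _ _ _ _ _ _ k1 k2) => //.
  - by rewrite ler1n.
  - by rewrite ler_nat.
  - by move=> i yi; rewrite overFraction_delta (le_trans (over_le_pplus _ _ _ yi)).
  - by move=> i yi; rewrite overFraction_delta (le_trans hm)// under_ge_pminus.
move=> P2 [[/andP[w1 w2] _] w3 hs].
have [hp hm] := P2 t w.
apply: biasedRound_W3 => //.
- by rewrite ler1n.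
- by rewrite ler_nat.
- by rewrite natr1 ler_nat.
- by move=> i yi; rewrite (le_trans (over_le_pplus _ _ _ yi))// -div1r.
- by move=> i yi; rewrite -div1r (le_trans hm)// under_ge_pminus.
have [s [sy sp]] := hs t w.
move=> i j ij; have [a iE] : exists a, i = s a by exists (s^-1%g i); rewrite permKV.
have [e jE] : exists e, j = s e by exists (s^-1%g j); rewrite permKV.
(* A strictly smaller load forces a later rank in any admissible labelling, so the way ties are
   broken is irrelevant. *)
rewrite iE jE; apply: sp; rewrite leqNgt; apply/negP => /ltnW ae.
by have := sy _ _ ae; rewrite -iE -jE leNgt ij.
Qed.

Lemma gap_le_maxDeviation t w : gap X t w <= maxDeviation X t w.
Proof.
have [|i hi] := @bigop.eq_bigmax 'I_n (load X t w); first by rewrite card_ord.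
rewrite /gap hi; apply: (@le_trans _ _ `|(load X t w i)%:R - (totalLoad X t w)%:R / n%:R|).
  exact: ler_norm.
exact: (le_bigmax_cond _ (fun i => `|(load X t w i)%:R - (totalLoad X t w)%:R / n%:R|)).
Qed.

(** [0 <= l] excludes that the default 0 of the maximum is what exceeds [l]. *)
Lemma maxDeviation_gtP t w (l : R) : 0 <= l -> l < maxDeviation X t w ->
  exists i, l < `|normOf (R := R) (loads X t w) i|.
Proof.
move=> l0 hl; apply: contrapT => nE.
move: hl; rewrite ltNge => /negP; apply; apply: bigmax_le => // i _.
rewrite leNgt; apply/negP => li; apply: nE; exists i.
by rewrite -normLoad_loads.
Qed.

Lemma measurable_maxDeviation_le t (l : R) :
  measurable [set w | (maxDeviation X t w <= l)%R].
Proof.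
pose g (f : {ffun 'I_n -> nat}) := \big[Num.max/0]_(i < n) `|normOf (R := R) f i|.
have -> : [set w | (maxDeviation X t w <= l)%R] =
    setT `&` (fun w => g (loads X t w)) @^-1` [set x | x <= l].
  rewrite setTI; apply/seteqP; split => w /=; rewrite /maxDeviation /g -normLoad_loads //.
by apply: (measurable_loads X t g) => //; rewrite -set_itvNyc.
Qed.

Lemma measurable_gap_le t (l : R) : measurable [set w | (gap X t w <= l)%R].
Proof.
pose g (f : {ffun 'I_n -> nat}) : R := (\max_(i < n) f i)%N%:R
  - (\sum_(j < n) f j)%N%:R / n%:R.
have gE w : gap X t w = g (loads X t w).
  rewrite /gap /g /totalLoad; congr (_%:R - _%:R / _).
    by apply: eq_bigr => i _; rewrite ffunE.
  by apply: eq_bigr => i _; rewrite ffunE.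
have -> : [set w | (gap X t w <= l)%R] =
    setT `&` (fun w => g (loads X t w)) @^-1` [set x | x <= l].
  by rewrite setTI; apply/seteqP; split => w /=; rewrite gE.
by apply: (measurable_loads X t g) => //; rewrite -set_itvNyc.
Qed.

End ProcessRounds.

(** * The tail bound *)

Section Tail.
Context {R : realType} {d : measure_display} {T : measurableType d}
        {P : probability T R} {n : nat}.
Variables (X : allocProcess P n) (wp wm N : nat) (c : R).
Let w : R := wm%:R.
Let h : R := N%:R^-1.
Hypothesis N0 : (0 < N)%N.
Hypothesis gs : goodScale w c h.
Hypothesis n8 : (8 <= n)%N.
Hypothesis n20w : (20 * wm <= n)%N.
Hypothesis nN : (N ^ 6 <= n)%N.
Hypothesis hW2 : condW2 X wp wm.
Hypothesis rd : forall t v,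
  biasedRound w c (normOf (loads X t v)) (dist X t v)
    (fun i => if normOf (R := R) (loads X t v) i < 0 then wm%:R else wp%:R).

Let k := (2 * N ^ 4 + 3)%N.
Let V (f : {ffun 'I_n -> nat}) : R := lyapunov w h (normOf f).

Let n0 : 0 < n%:R :> R. Proof. by rewrite ltr0n (leq_trans _ n8). Qed.
Let n4 : 4 <= n%:R :> R. Proof. by rewrite ler_nat (leq_trans _ n8). Qed.
Let n20 : 20 * w <= n%:R. Proof. by rewrite -natrM ler_nat. Qed.

Let q : R := h ^+ 12 / (4 * n%:R).

Lemma decay_rate_01 : 0 <= q <= 1.
Proof.
have h0 : 0 <= h ^+ 12 by rewrite exprn_ge0// ltW// (scale_gt0 gs).
have h1 : h ^+ 12 <= 1 by rewrite exprn_ile1 ?(scale_le1 gs)// ltW// (scale_gt0 gs).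
have n04 : 0 < 4 * n%:R :> R by rewrite mulr_gt0.
rewrite /q; apply/andP; split; first by rewrite divr_ge0// ltW.
by rewrite ler_pdivrMr// mul1r; have := n4; lra.
Qed.

Lemma lyapunov_round t v :
  \sum_(j < n) dist X t v j * V (nextLoads R wp wm (loads X t v) j) <=
  (1 - q) * V (loads X t v) + 2 * n%:R ^+ k.
Proof.
have /andP[q0 q1] := decay_rate_01.
have V0 : 0 <= V (loads X t v) by exact: expR_ge0.
under eq_bigr do rewrite /V normOf_nextLoads.
have [large|] := boolP ((n%:R / h ^+ 6 <= expPot (h ^+ 6) (normOf (loads X t v))) ||
   (n%:R / h ^+ 4 <= expPot (- h ^+ 4) (normOf (loads X t v)))).
  apply: (le_trans (lyapunov_drift_large (rd t v) gs n20 large)).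
  by rewrite lerDl mulr_ge0// exprn_ge0// ltW.
rewrite negb_or -!ltNge => /andP[/ltW s1 /ltW s2].
apply: (le_trans (lyapunov_drift_crude (rd t v) gs n20)).
have := lyapunov_upper N0 gs n4 nN _ s1 s2; rewrite -/k -/(V _) => Vk.
have : 0 <= (1 - q) * V (loads X t v) by rewrite mulr_ge0// subr_ge0.
lra.
Qed.

(** The decay removes [n^k * (h^12 * n^2) * (n / 4)], which is at least [2 * n^k] since [N ^ 6 <= n]
    and [8 <= n]. This is the origin of the exponent [k + 4] and of the bound 8. *)
Lemma decay_balance : (1 - q) * n%:R ^+ (k + 4) + 2 * n%:R ^+ k <= n%:R ^+ (k + 4) :> R.
Proof.
have nk : 0 < n%:R ^+ k :> R by rewrite exprn_gt0.
have hn : 1 <= h ^+ 12 * n%:R ^+ 2.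
  rewrite /h exprVn -(ler_pM2l (_ : 0 < N%:R ^+ 12)) ?exprn_gt0 ?ltr0n//.
  rewrite mulr1 mulrA divff ?mul1r; last by rewrite expf_neq0// pnatr_eq0 -lt0n.
  rewrite (exprM _ 6 2) lerXn2r ?nnegrE ?exprn_ge0 ?ler0n//.
  by rewrite -natrX ler_nat.
have n8R : 8 <= n%:R :> R by rewrite ler_nat.
have -> : (1 - q) * n%:R ^+ (k + 4) = n%:R ^+ (k + 4) -
    n%:R ^+ k * (h ^+ 12 * n%:R ^+ 2 * n%:R / 4).
  by rewrite mulrBl mul1r exprD /q; field; rewrite gt_eqF.
have : n%:R ^+ k * 2 <= n%:R ^+ k * (h ^+ 12 * n%:R ^+ 2 * n%:R / 4).
  rewrite ler_pM2l//.
  have := ler_wpM2r (ltW n0) hn; lra.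
lra.
Qed.

Lemma lyapunov_expectation t :
  (\int[P]_v (V (loads X t v))%:E <= (n%:R ^+ (k + 4))%:E)%E.
Proof.
have nk : 0 < n%:R ^+ (k + 4) :> R by rewrite exprn_gt0.
have /andP[q0 q1] := decay_rate_01.
have V0 f : 0 <= V f by exact: expR_ge0.
have h0 := scale_gt0 gs.
elim: t => [|t IH].
  (* Initially every exponential potential equals [n], hence is small, and [lyapunov_upper]
     applies. *)
  have e v : normOf (R := R) (loads X 0 v) = fun=> 0.
    apply/funext => i; rewrite /normOf ffunE load0 big1 ?mul0r ?subr0//.
    by move=> j _; rewrite ffunE load0.
  have eP (a : R) v : expPot a (normOf (loads X 0 v)) = n%:R.
    by rewrite e /expPot; under eq_bigr do rewrite mulr0 expR0; rewrite sumr_const card_ord.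
  have s (l : nat) : n%:R <= n%:R / h ^+ l.
    by rewrite ler_pdivlMr ?exprn_gt0// ler_piMr ?(ltW n0)// exprn_ile1 ?(scale_le1 gs)// ltW.
  have Vb v : V (loads X 0 v) <= n%:R ^+ (k + 4).
    apply: (@le_trans _ _ (n%:R ^+ k)).
      by apply: (lyapunov_upper N0 gs n4 nN); rewrite eP.
    by rewrite ler_weXn2l ?leq_addr//; have := n4; lra.
  apply: (@le_trans _ _ (\int[P]_v (cst (n%:R ^+ (k + 4))%:E v))%E).
    apply: ge0_le_integral => //.
    - by move=> v _; rewrite lee_fin.
    - by apply/measurable_EFinP; exact: measurable_loads.
    - by move=> v _; rewrite lee_fin.
  rewrite integral_cst// [X in (_ * X)%E](_ : _ = 1%E) ?mule1//.
  exact: probability_setT.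
apply: (le_trans (expectation_step X t V (nextLoads R wp wm) (1 - q) (2 * n%:R ^+ k)
   V0 _ _ _ (lyapunov_round t))).
- by rewrite subr_ge0.
- by rewrite mulr_ge0// exprn_ge0// ltW.
- by move=> v; exact: loads_nextLoads.
apply: (@le_trans _ _ ((1 - q)%:E * (n%:R ^+ (k + 4))%:E + (2 * n%:R ^+ k)%:E)%E).
  by rewrite leeD2r// lee_wpmul2l// lee_fin subr_ge0.
by rewrite -EFinM -EFinD lee_fin decay_balance.
Qed.

(** Chosen so that [h ^+ 8 / 4 * kappa = k + 7]: Markov's inequality against [n ^ (k + 4)] then
    leaves [n ^ -3]. *)
Let kappa : R := 4 * N%:R ^+ 8 * (k + 7)%:R.

Lemma maxDeviation_tail t :
  ((1 - n%:R ^- 3)%:E <= P [set v | (maxDeviation X t v <= kappa * ln n%:R)%R])%E.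
Proof.
set A := [set v | _].
have mA : measurable A by exact: measurable_maxDeviation_le.
have h0 := scale_gt0 gs.
have l0 : 0 <= kappa * ln n%:R.
  rewrite mulr_ge0 ?ln_ge0//; last by have := n4; lra.
  by rewrite /kappa !mulr_ge0 ?exprn_ge0 ?ler0n.
have VA v : (~` A) v -> n%:R ^+ (k + 7) <= V (loads X t v).
  rewrite /A /= => /negP; rewrite -ltNge => /(maxDeviation_gtP X t v _ l0) [i hi].
  apply: le_trans (lyapunov_lower N0 gs n4 _ i).
  rewrite -[leLHS]lnK ?posrE ?exprn_gt0// ler_expR lnXn//.
  have -> : ln n%:R *+ (k + 7) = h ^+ 8 / 4 * (kappa * ln n%:R).
    rewrite /kappa /h -mulr_natl; field.
    by rewrite pnatr_eq0 -lt0n.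
  by rewrite ler_wpM2l ?(ltW hi)// divr_ge0// exprn_ge0// ltW.
have mC : measurable (~` A) by exact: measurableC.
have mV : measurable_fun setT (fun v => (V (loads X t v))%:E).
  by apply/measurable_EFinP; exact: measurable_loads.
have V0 f : 0 <= V f by exact: expR_ge0.
have nk j : 0 < n%:R ^+ j :> R by rewrite exprn_gt0.
have markov : ((n%:R ^+ (k + 7))%:E * P (~` A) <= (n%:R ^+ (k + 4))%:E)%E.
  apply: le_trans (lyapunov_expectation t).
  apply: (@le_trans _ _ (\int[P]_(v in ~` A) (V (loads X t v))%:E)%E).
    rewrite -integral_cst//; apply: ge0_le_integral => //.
    - by move=> v _; rewrite lee_fin ltW.
    - exact: measurable_funTS.
  by apply: ge0_subset_integral => // v _; rewrite lee_fin.
have pC : (P (~` A) <= (n%:R ^- 3)%:E)%E.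
  move: markov; have : P (~` A) \is a fin_num by rewrite fin_num_measure.
  move=> /fineK <-; rewrite -EFinM !lee_fin => hm.
  rewrite -(ler_pM2l (nk (k + 7)%N)); apply: (le_trans hm).
  rewrite !exprD le_eqVlt; apply/orP; left; apply/eqP.
  by field; rewrite gt_eqF.
have -> : P A = (1 - P (~` A))%E.
  by rewrite -[in LHS](setCK A) probability_setC.
by rewrite EFinB; apply: leeB.
Qed.

End Tail.

Theorem mainTheorem2 (R : realType) (k1 k2 : R) (wplus wminus : nat) :
  exists (kappa : R) (n0 : nat), 0 < kappa /\
  forall (n : nat) (d : measure_display) (T : measurableType d)
    (P : probability T R) (X : allocProcess P n),
  (n0 <= n)%N ->
  (condP3 X k1 k2 /\ condW2 X wplus wminus) \/
  (condP2 X /\ condW3 X wplus wminus) ->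
  forall m : nat, (1 <= m)%N ->
    ((1 - n%:R ^- 3)%:E <=
       P [set w | (maxDeviation X m w <= kappa * ln n%:R)%R])%E /\
    ((1 - n%:R ^- 3)%:E <=
       P [set w | (gap X m w <= kappa * ln n%:R)%R])%E.
Proof.
(* One rate serves both alternatives: at most [k1] and [k2] when these are positive, and at most 1,
   which the weight gap [wm - wp] dominates. *)
have [c c01 ck] : exists2 c : R, 0 < c <= 1 &
    (0 < k1 -> 0 < k2 -> c <= k1 /\ c <= k2).
  have [k10|k10] := boolP (0 < k1); last by exists 1; rewrite ?ltr01 ?lexx.
  have [k20|k20] := boolP (0 < k2); last by exists 1; rewrite ?ltr01 ?lexx.
  exists (Num.min 1 (Num.min k1 k2)); first by rewrite !lt_min ltr01 k10 k20 ge_min lexx.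
  by move=> _ _; split; rewrite !ge_min lexx !orbT.
(* For [wminus = 0] the requirement [1 <= wplus <= wminus] is contradictory, so any constant
   works. *)
have [wm0|wm0] := posnP wminus.
  exists 1, 0%N; split=> // n d T P X _ hc; exfalso; move: hc.
  by rewrite wm0 => -[[_ []]|[_ [[]]]]; case: (wplus).
have [|N N0 gs] := exists_goodScale (wminus%:R : R) c _ c01; first by rewrite ler1n.
exists (4 * N%:R ^+ 8 * (2 * N ^ 4 + 3 + 7)%:R), (20 * wminus + 8 + N ^ 6)%N.
split; first by rewrite !mulr_gt0 ?exprn_gt0 ?ltr0n// addnS.
move=> n d T P X nn hc m _.
have n8 : (8 <= n)%N by apply: leq_trans nn; rewrite -addnA addnCA leq_addr.
have n20 : (20 * wminus <= n)%N by apply: leq_trans nn; rewrite -addnA leq_addr.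
have nN : (N ^ 6 <= n)%N by apply: leq_trans nn; rewrite leq_addl.
have hW2 : condW2 X wplus wminus by case: hc => -[_ //] [].
have n0 : (0 < n)%N := leq_trans (isT : 0 < 8)%N n8.
have rd := process_round X wplus wminus n0 c k1 k2 c01 ck hc.
have tail := maxDeviation_tail X wplus wminus N c N0 gs n8 n20 nN hW2 rd m.
split=> //; apply: (le_trans tail); apply: le_measure; rewrite ?inE.
- exact: measurable_maxDeviation_le.
- exact: measurable_gap_le.
by move=> v /=; apply: le_trans; exact: gap_le_maxDeviation.
Qed.
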